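(* Let $n\ge2$, $1\le i\le n-1$, $m\in\mathbb N_0$ be integers, $\kappa\ge0$ real, and set, for $y\in(0,1)$, $$\Psi_0(y)=y^{\frac m2}\begin{pmatrix}y^{\frac12}&1\\ y^{\frac12}&\frac{(m+1)-y(m+n-i+1)}{i-n}\end{pmatrix},\qquad T^{(\kappa)}=\begin{pmatrix}1&0\\0&\frac{n-i}{i+\kappa}\end{pmatrix},$$ $$W^{(n,m,i,\kappa)}(y)=y^\kappa(1-y)^{n-1+\kappa}\,\Psi_0(y)\,T^{(\kappa)}\,\Psi_0(y)^*,$$ $$D^{(n,m,i,\kappa)}=y(1-y)\partial_y^2+\partial_y\big(C+\kappa-y(U+2\kappa)\big)-\big(V+\kappa U+\kappa(\kappa-1)\big),$$ with $$C=\begin{pmatrix}\frac{(m+1)(m+n+2-i)}{n+m+1-i}&\frac{n-i}{n+m+1-i}\\ \frac{m+1}{n+m+1-i}&\frac{m^2-2i+2n-mi+2m+mn+1}{n+m+1-i}\end{pmatrix},\quad U=\begin{pmatrix}n+m+2&0\\-1&n+m+3\end{pmatrix},\quad V=\begin{pmatrix}0&0\\0&n+m+1-i\end{pmatrix}.$$ Then $(W^{(n,m,i,\kappa)},D^{(n,m,i,\kappa)})$ is a matrix-valued classical pair on $(0,1)$. Moreover, the monic orthogonal polynomials $(Q_d^{(n,m,i,\kappa)})_d$ with respect to $W^{(n,m,i,\kappa)}$ satisfy $$\partial_y\,Q_d^{(n,m,i,\kappa)}(y)=d\,Q_{d-1}^{(n,m,i,\kappa+1)}(y),$$ and for each $d$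 there is a constant matrix $G_d$ such that $$Q_d^{(n,m,i,\kappa)}(y)=G_d\,\big(\partial_y^d\,W^{(n,m,i,\kappa+d)}(y)\big)\,\big(W^{(n,m,i,\kappa)}(y)\big)^{-1}.$$
   Context: Scalars in matrix expressions stand for multiples of the identity; $^*$ is conjugate transpose. Differential operators act from the right: for $D=\partial_y^2F_2+\partial_yF_1+F_0$, $PD=P''F_2+P'F_1+PF_0$. A matrix-valued classical pair on $(0,1)$ is a pair $(W,D)$ where $W:(0,1)\to\mathbb C^{N\times N}$ is smooth, positive definite, with finite moments, and $D=\partial_y^2F_2+\partial_yF_1+F_0$ with $F_j$ a matrix polynomial of degree at most $j$, such that $\langle PD,Q\rangle_W=\langle P,QD\rangle_W$ for all matrix polynomials $P,Q$, where $\langle P,Q\rangle_W=\int_0^1P(y)W(y)Q(y)^*dy$. The monic orthogonal polynomials with respect to $W$ are the unique matrix polynomials $Q_d(y)=y^dI+\cdots$, $d\in\mathbb N_0$, of degree $d$ with $\langle Q_d,Q_{d'}\rangle_W=0$ for $d\ne d'$. *)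

(* Defs.v *)
From HB Require Import structures.
From mathcomp Require Import all_boot all_order all_algebra.
From mathcomp Require Import spectral complex.
From mathcomp Require Import all_classical all_reals all_analysis.

Set Implicit Arguments.
Unset Strict Implicit.
Unset Printing Implicit Defensive.

Import Order.TTheory GRing.Theory Num.Theory.
Import numFieldNormedType.Exports.

Local Open Scope classical_set_scope.
Local Open Scope ring_scope.
Local Open Scope complex_scope.
Local Open Scope sesquilinear_scope.

(** Functions of a real variable with values in [R[i]] are differentiated and
    integrated through their real and imaginary parts, and matrix-valued ones
    entry by entry. *)

Definition cderiven (R : realType) (k : nat) (f : R -> R[i]) (y : R) : R[i] :=
  derive1n k (fun t => complex.Re (f t)) y
    +i* derive1n k (fun t => complex.Im (f t)) y.

Definition mxderiven (R : realType) (p q k : nat) (F : R -> 'M[R[i]]_(p, q))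
    (y : R) : 'M[R[i]]_(p, q) :=
  \matrix_(a, b) cderiven k (fun t => F t a b) y.

Definition smooth_on (R : realType) (D : set R) (f : R -> R) : Prop :=
  forall (k : nat) (y : R), D y -> derivable (derive1n k f) y 1.

Definition mxsmooth_on (R : realType) (p q : nat) (D : set R)
    (F : R -> 'M[R[i]]_(p, q)) : Prop :=
  forall a b, smooth_on D (fun t => complex.Re (F t a b)) /\
              smooth_on D (fun t => complex.Im (F t a b)).

Definition mxintegrable_on (R : realType) (p q : nat) (D : set R)
    (F : R -> 'M[R[i]]_(p, q)) : Prop :=
  forall a b,
    (@lebesgue_measure R).-integrable D
      (fun t => (complex.Re (F t a b))%:E) /\
    (@lebesgue_measure R).-integrable D
      (fun t => (complex.Im (F t a b))%:E).

Definition mxintegral (R : realType) (p q : nat) (D : set R)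
    (F : R -> 'M[R[i]]_(p, q)) : 'M[R[i]]_(p, q) :=
  \matrix_(a, b)
    (Rintegral (@lebesgue_measure R) D (fun t => complex.Re (F t a b))
       +i* Rintegral (@lebesgue_measure R) D (fun t => complex.Im (F t a b))).

Definition posdefmx (R : realType) (N : nat) (A : 'M[R[i]]_N) : Prop :=
  A^t* = A /\
  forall v : 'rV[R[i]]_N, v != 0 -> 0 < (v *m A *m v^t*) 0 0.

(** Matrix polynomials of size [N.+1] are elements of
    [{poly 'M[R[i]]_N.+1}]: the indeterminate is central, and the degree is
    [size P - 1]. Evaluation at a real number is evaluation at the
    corresponding scalar matrix. *)

Definition mpeval (R : realType) (N : nat) (P : {poly 'M[R[i]]_N.+1}) (y : R) :
    'M[R[i]]_N.+1 :=
  P.[(y%:C)%:M].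

(** [DiffOp F2 F1 F0] stands for [d^2 F2 + d F1 + F0], acting on matrix
    polynomials from the right. *)
Record diffop (R : realType) (N : nat) := DiffOp {
  F2of : {poly 'M[R[i]]_N.+1};
  F1of : {poly 'M[R[i]]_N.+1};
  F0of : {poly 'M[R[i]]_N.+1} }.

Definition diffop_app (R : realType) (N : nat) (P : {poly 'M[R[i]]_N.+1})
    (D : diffop R N) : {poly 'M[R[i]]_N.+1} :=
  derivn 2 P * F2of D + deriv P * F1of D + P * F0of D.

Definition inner (R : realType) (N : nat) (W : R -> 'M[R[i]]_N.+1)
    (P Q : {poly 'M[R[i]]_N.+1}) : 'M[R[i]]_N.+1 :=
  mxintegral `]0, 1[ (fun y => mpeval P y *m W y *m (mpeval Q y)^t*).

(** A weight on (0,1) is a function on all of [R], of which only the values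
    on (0,1) matter. *)
Definition is_weight (R : realType) (N : nat) (W : R -> 'M[R[i]]_N.+1) : Prop :=
  [/\ mxsmooth_on `]0, 1[ W,
      forall y : R, y \in `]0, 1[ -> posdefmx (W y) &
      forall k : nat, mxintegrable_on `]0, 1[ (fun y => (y ^+ k)%:C *: W y)].

Definition classical_pair (R : realType) (N : nat) (W : R -> 'M[R[i]]_N.+1)
    (D : diffop R N) : Prop :=
  [/\ is_weight W,
      [/\ (size (F2of D) <= 3)%N, (size (F1of D) <= 2)%N
        & (size (F0of D) <= 1)%N] &
      forall P Q : {poly 'M[R[i]]_N.+1},
        inner W (diffop_app P D) Q = inner W P (diffop_app Q D)].

Definition monic_orthogonal (R : realType) (N : nat) (W : R -> 'M[R[i]]_N.+1)
    (Q : nat -> {poly 'M[R[i]]_N.+1}) : Prop :=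
  (forall d, Q d \is monic /\ size (Q d) = d.+1) /\
  (forall d d', d <> d' -> inner W (Q d) (Q d') = 0).

Definition mx2 (T : Type) (a b c d : T) : 'M[T]_2 :=
  \matrix_(j < 2, k < 2)
    if j == 0 then (if k == 0 then a else b) else (if k == 0 then c else d).

Section Family.
Variables (R : realType) (n m i : nat) (kappa : R).

Definition Psi0 (y : R) : 'M[R[i]]_2 :=
  map_mx (real_complex R)
    (y `^ (m%:R / 2) *:
       mx2 (y `^ 2^-1) 1
           (y `^ 2^-1) (((m%:R + 1) - y * (m%:R + n%:R - i%:R + 1))
                          / (i%:R - n%:R))).

Definition Tmx : 'M[R[i]]_2 :=
  map_mx (real_complex R) (mx2 1 0 0 ((n%:R - i%:R) / (i%:R + kappa))).

Definition Wmx (y : R) : 'M[R[i]]_2 :=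
  (y `^ kappa * (1 - y) `^ (n%:R - 1 + kappa))%:C
    *: (Psi0 y *m Tmx *m (Psi0 y)^t*).

Definition Cmx : 'M[R[i]]_2 :=
  let n := n%:R in let m := m%:R in let i := i%:R in
  let q := n + m + 1 - i in
  mx2 ((m + 1) * (m + n + 2 - i) / q) ((n - i) / q)
      ((m + 1) / q)
      ((m ^+ 2 - 2 * i + 2 * n - m * i + 2 * m + m * n + 1) / q).

Definition Umx : 'M[R[i]]_2 :=
  mx2 (n%:R + m%:R + 2) 0
      (-1)              (n%:R + m%:R + 3).

Definition Vmx : 'M[R[i]]_2 :=
  mx2 0 0
      0 (n%:R + m%:R + 1 - i%:R).

Definition Dop : diffop R 1 :=
  let k := kappa%:C in
  DiffOp ('X * (1 - 'X))
         ((Cmx + k%:M)%:P - 'X * (Umx + (2 * k)%:M)%:P)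
         (- (Vmx + k *: Umx + (k * (k - 1))%:M)%:P).

End Family.

(* Main.v *)
Require Import Defs.
From HB Require Import structures.
From mathcomp Require Import all_boot all_order all_algebra.
From mathcomp Require Import spectral complex.
From mathcomp Require Import all_classical all_reals all_analysis.
From mathcomp Require Import zify ring lra.

(** On (0,1) the weight is [W_k = w_{a,b} M_k] with [w_{a,b} = y^a (1-y)^b],
    [a = m + k], [b = n - 1 + k] and [M_k] a matrix polynomial. Everything is
    driven by the operator [delta p = y(1-y) p' + ((a+1)(1-y) - (b+1) y) p],
    which satisfies [(w_{a+1,b+1} p)' = w_{a,b} delta p], so that
    [w_{a,b} delta p] has integral zero.

    Symmetry of [D]: the integrand of [<PD,Q> - <P,QD>] is [w_{a,b}] times
    [delta (P' M adj Q - P M (adj Q)' + P Z adj Q)] for a constant antisymmetric [Z].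

    Raising operator: [y(1-y) M_{k+1} = Phi_k M_k] and
    [delta M_{k+1} = A_k M_k] for polynomials [Phi_k], [A_k] of degrees 2 and 1.
    Hence [S_k P = P' Phi_k + P A_k] satisfies
    [(P W_{k+1})' = (S_k P) W_k], and [<S_k P, Q>_k = - <P, Q'>_{k+1}]. The
    polynomial [S_k S_{k+1} ... S_{k+d-1} 1] has degree [d] and invertible
    leading coefficient, is orthogonal to all polynomials of lower degree, and
    times [W_k] it is the [d]-th derivative of [W_{k+d}]: this is the Rodrigues
    formula. By the same adjunction, the derivative of an orthogonal polynomial
    is orthogonal for the parameter [k+1]. *)

Set Implicit Arguments.
Unset Strict Implicit.
Unset Printing Implicit Defensive.

Import Order.TTheory GRing.Theory Num.Theory.
Import numFieldNormedType.Exports.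

Local Open Scope ring_scope.

(** * The scalar Jacobi weight: derivatives, boundary behaviour and integrals *)

Definition wgt {R : realType} (a b y : R) : R := y `^ a * (1 - y) `^ b.

(** The parameters are the exponents of the weight being differentiated: over [wgt a b] the operator
    of the overview is [delta (a + 1) (b + 1)]. *)
Definition delta {R : realType} (a b : R) (p : {poly R}) : {poly R} :=
  'X * (1 - 'X) * p^`() + (a *: (1 - 'X) - b *: 'X) * p.

Lemma wgt_gt0 (R : realType) (a b y : R) : 0 < y < 1 -> 0 < wgt a b y.
Proof.
by case/andP=> y0 y1; rewrite /wgt mulr_gt0 ?powR_gt0 // subr_gt0.
Qed.

Lemma is_derive_wgt (R : realType) (a b y : R) (p : {poly R}) : 0 < y < 1 ->
  is_derive y 1 (fun t => wgt a b t * p.[t])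
    (wgt (a - 1) (b - 1) y * (delta a b p).[y]).
Proof.
case/andP=> y0 y1; have y1' : 0 < 1 - y by rewrite subr_gt0.
have h1 : is_derive y 1 (fun t : R => t `^ a) (a * y `^ (a - 1)).
  exact: is_derive1_powR.
have h2 : is_derive y 1 (fun t : R => (1 - t) `^ b) (- (b * (1 - y) `^ (b - 1))).
  have h : is_derive (1 - y) 1 (fun t : R => t `^ b) (b * (1 - y) `^ (b - 1)).
    exact: is_derive1_powR.
  have h' : is_derive y 1 (fun t : R => 1 - t) (- 1).
    have := is_deriveB (is_derive_cst (1 : R) y 1) (is_derive_id y 1).
    by move=> h'; apply: (is_derive_eq h'); rewrite sub0r.
  have h'' := @is_derive1_comp _ _ (fun t : R => 1 - t) _ _ _ h h'.
  by apply: (is_derive_eq h''); rewrite mulrN1.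
have h3 : is_derive y 1 (horner p) (p^`()).[y] by exact: is_derive_poly.
have h4 := is_deriveM (is_deriveM h1 h2) h3.
apply: (is_derive_eq h4); rewrite /wgt /delta !hornerE !fctE /GRing.scale /=.
have -> : y `^ a = y * y `^ (a - 1).
  by rewrite powRB ?(gt_eqF y0) ?implybT // powRr1 ?ltW // mulrC divfK ?gt_eqF.
have -> : (1 - y) `^ b = (1 - y) * (1 - y) `^ (b - 1).
  rewrite powRB ?(gt_eqF y1') ?implybT // powRr1 ?ltW // mulrC divfK ?gt_eqF //.
ring.
Qed.

Fixpoint deltan {R : realType} (k : nat) (a b : R) (p : {poly R}) : {poly R} :=
  if k is k'.+1 then delta (a - k'%:R) (b - k'%:R) (deltan k' a b p) else p.

Lemma derive1n_wgt (R : realType) (k : nat) (a b y : R) (p : {poly R}) :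
  0 < y < 1 ->
  derive1n k (fun t => wgt a b t * p.[t]) y
    = wgt (a - k%:R) (b - k%:R) y * (deltan k a b p).[y].
Proof.
elim: k y => [|k IH] y hy; first by rewrite /= !subr0.
rewrite derive1nS derive1E -natr1 !opprD !addrA /=.
have := is_derive_wgt (a - k%:R) (b - k%:R) (deltan k a b p) hy.
(* The induction hypothesis holds only inside (0,1), but agreement near [y] is enough to
   differentiate it. *)
move/(near_eq_is_derive (f := _)) => H.
have /H h : \near y, wgt (a - k%:R) (b - k%:R) y * (deltan k a b p).[y]
    = derive1n k (fun t => wgt a b t * p.[t]) y.
  have : \forall z \near y, z \in `]0, 1[ by apply: near_in_itvoo; rewrite in_itv.
  by apply: filterS => z /=; rewrite in_itv /= => hz; rewrite IH.
by rewrite derive_val.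
Qed.

Lemma derivable_derive1n_wgt (R : realType) (k : nat) (a b y : R) (p : {poly R}) :
  0 < y < 1 -> derivable (derive1n k (fun t => wgt a b t * p.[t])) y 1.
Proof.
move=> hy.
have := is_derive_wgt (a - k%:R) (b - k%:R) (deltan k a b p) hy.
case=> + _; apply: near_eq_derivable.
have : \forall z \near y, z \in `]0, 1[ by apply: near_in_itvoo; rewrite in_itv.
by apply: filterS => z /=; rewrite in_itv /= => hz; rewrite derive1n_wgt.
Qed.

Lemma cvg_powR_right0 (R : realType) (a : R) : 0 <= a ->
  (t `^ a @[t --> 0^'+] --> (0 : R) `^ a)%classic.
Proof.
(* For [a = 0] the function is constantly 1, and its value at 0 is also 1 by the convention on real
   powers. A positive exponent gives the limit 0. *)
rewrite le_eqVlt => /orP[/eqP <-|a0].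
  rewrite powRr0; under eq_fun do rewrite powRr0.
  exact: cvg_cst.
rewrite powR0 ?gt_eqF //; exact: powR_cvg0.
Qed.

Lemma cvg_onem_left1 (R : realType) :
  ((1 - t : R) @[t --> 1^'-] --> 0^'+)%classic.
Proof.
move=> A [e e0 hA]; exists e => // t /= + t1.
rewrite /ball_ /= => ht; apply: hA; rewrite /= ?subr_gt0 //.
by rewrite sub0r normrN.
Qed.

(** Nonnegative exponents let the weight extend continuously to the endpoints. This gives
    integrability and the boundary terms of the fundamental theorem of calculus. *)
Lemma wgt_LRcontinuous (R : realType) (a b : R) (p : {poly R}) :
  0 <= a -> 0 <= b ->
  derivable_oo_LRcontinuous (fun t => wgt a b t * p.[t]) 0 1.
Proof.
move=> a0 b0; have cp (y : R) : (horner p @ y --> p.[y])%classic.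
  exact: continuous_horner.
have cpow (c y : R) : 0 < y -> (t `^ c @[t --> y] --> y `^ c)%classic.
  move=> y0; have : derivable (fun t => t `^ c) y 1.
    by apply: derivable_powR; rewrite in_itv /= y0.
  by move/derivable1_diffP/differentiable_continuous.
split.
- by move=> y; rewrite in_itv /= => hy; case: (is_derive_wgt a b p hy).
- apply: cvgM; last exact: cvg_at_right_filter.
  apply: cvgM; first exact: cvg_powR_right0.
  apply: cvg_at_right_filter.
  have h0 : ((1 - t : R) @[t --> (0 : R)] --> (1 - 0 : R))%classic.
    by apply: cvgB; [exact: cvg_cst|exact: cvg_id].
  have h1 : 0 < (1 - 0 : R) by rewrite subr0.
  exact: (cvg_comp _ _ h0 (cpow b _ h1)).
- apply: cvgM; last exact: cvg_at_left_filter.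
  apply: cvgM; first by apply: cvg_at_left_filter; exact: cpow.
  rewrite subrr.
  exact: (cvg_comp _ _ (@cvg_onem_left1 R) (cvg_powR_right0 b0)).
Qed.

Lemma wgt_integrable (R : realType) (a b : R) (p : {poly R}) :
  0 <= a -> 0 <= b ->
  (@lebesgue_measure R).-integrable `[0, 1]%classic
    (fun t => (wgt a b t * p.[t])%:E).
Proof.
move=> a0 b0; apply: continuous_compact_integrable; first exact: segment_compact.
exact/derivable_oo_LRcontinuous_within/wgt_LRcontinuous.
Qed.

Lemma wgt_integrable_oo (R : realType) (a b : R) (p : {poly R}) :
  0 <= a -> 0 <= b ->
  (@lebesgue_measure R).-integrable `]0, 1[%classic
    (fun t => (wgt a b t * p.[t])%:E).
Proof.
move=> a0 b0; apply: integrableS (wgt_integrable p a0 b0) => //.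
exact: subset_itvW.
Qed.

Definition wint {R : realType} (a b : R) (p : {poly R}) : R :=
  Rintegral (@lebesgue_measure R) `]0, 1[%classic (fun t => wgt a b t * p.[t]).

(** By [is_derive_wgt] the integrand is the derivative of [wgt (a + 1) (b + 1)] times [p], and the
    exponents [a + 1], [b + 1] are positive, so both boundary values vanish. *)
Lemma wint_delta (R : realType) (a b : R) (p : {poly R}) :
  0 <= a -> 0 <= b -> wint a b (delta (a + 1) (b + 1) p) = 0.
Proof.
move=> a0 b0; rewrite /wint.
have a1 : 0 < a + 1 by lra.
have b1 : 0 < b + 1 by lra.
have w0 : wgt (a + 1) (b + 1) 0 = 0 by rewrite /wgt powR0 ?gt_eqF // mul0r.
have w1 : wgt (a + 1) (b + 1) 1 = 0.
  by rewrite /wgt subrr (@powR0 _ (b + 1)) ?gt_eqF // mulr0.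
rewrite Rintegral_itv_bndo_bndc; last exact: wgt_integrable_oo.
rewrite Rintegral_itv_obnd_cbnd; last first.
  by apply: integrableS (wgt_integrable _ a0 b0) => //; exact: subset_itv_oc_cc.
rewrite /Rintegral (continuous_FTC2
  (F := fun t => wgt (a + 1) (b + 1) t * p.[t])) //.
- by rewrite w0 w1 !mul0r -EFinB subrr.
- exact/derivable_oo_LRcontinuous_within/wgt_LRcontinuous.
- by apply: wgt_LRcontinuous; exact: ltW.
- move=> y; rewrite in_itv /= => hy; rewrite derive1E.
  by have := is_derive_wgt (a + 1) (b + 1) p hy; rewrite !addrK => h; rewrite derive_val.
Qed.

Lemma wintD (R : realType) (a b : R) (p q : {poly R}) : 0 <= a -> 0 <= b ->
  wint a b (p + q) = wint a b p + wint a b q.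
Proof.
move=> a0 b0; rewrite /wint -RintegralD //; try exact: wgt_integrable_oo.
by apply: eq_Rintegral => t _; rewrite hornerD mulrDr.
Qed.

Lemma wintZ (R : realType) (a b c : R) (p : {poly R}) : 0 <= a -> 0 <= b ->
  wint a b (c *: p) = c * wint a b p.
Proof.
move=> a0 b0; rewrite /wint -RintegralZl //; last exact: wgt_integrable_oo.
by apply: eq_Rintegral => t _; rewrite hornerZ mulrCA.
Qed.

Lemma wint_gt0 (R : realType) (a b : R) : 0 <= a -> 0 <= b -> 0 < wint a b 1.
Proof.
(* On the interval from 1/4 to 1/2, of length 1/4, [y] is at least 1/4 and [1 - y] at least 1/2, so
   the weight is at least [c]. *)
move=> a0 b0; pose c : R := 4^-1 `^ a * 2^-1 `^ b.
have c0 : 0 < c by rewrite mulr_gt0 ?powR_gt0 // invr_gt0.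
have hi := wgt_integrable_oo 1 a0 b0.
have fin : (\int[@lebesgue_measure R]_(t in `]0%R, 1%R[%classic)
    (wgt a b t * (1 : {poly R}).[t])%:E)%E \is a fin_num.
  exact: integrable_fin_num.
rewrite /wint /Rintegral -lte_fin fineK //.
apply: (@lt_le_trans _ _ (c * 4^-1)%:E); first by rewrite lte_fin mulr_gt0 ?invr_gt0.
pose D : set R := `]4^-1, 2^-1[%classic.
have mD : measurable D by exact: measurable_itv.
have sub : (D `<=` `]0%R, 1%R[)%classic.
  by apply: subset_itv; rewrite bnd_simp ?invr_ge0 ?invf_le1 //; lra.
have hle : ((\int[@lebesgue_measure R]_(t in D)
    (wgt a b t * (1 : {poly R}).[t])%:E) <= 
   (\int[@lebesgue_measure R]_(t in `]0%R, 1%R[%classic)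
    (wgt a b t * (1 : {poly R}).[t])%:E))%E.
  apply: ge0_subset_integral => //.
    by case/integrableP : hi.
  move=> t /=; rewrite in_itv /= => ht.
  by rewrite lee_fin hornerC mulr1 ltW // wgt_gt0.
apply: le_trans hle.
have -> : (c * 4^-1)%:E
    = (\int[@lebesgue_measure R]_(t in D) (cst c%:E t))%E.
  have lD : lebesgue_measure D = (4^-1)%:E.
    rewrite /D lebesgue_measure_itv /= lte_fin ifT; last by lra.
    by rewrite -EFinB; congr (_%:E); field.
  by apply/esym; rewrite integral_cst //; apply: etrans (congr1 (fun u => c%:E * u)%E lD) _.
apply: ge0_le_integral => //.
- by move=> t _; rewrite lee_fin ltW.
- by apply: (measurable_funS _ sub) => //; case/integrableP : hi.
- move=> t; rewrite /D /= in_itv /= => /andP[t1 t2].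
  rewrite lee_fin hornerC mulr1 /wgt /c.
  apply: ler_pM; rewrite ?powR_ge0 //; apply: ge0_ler_powR; rewrite ?nnegrE //; lra.
Qed.

(** * Matrix polynomials seen through real-linear functionals *)

Lemma coefX_deriv (S : nzRingType) (p : {poly S}) k :
  (if k == 0%N then 0 else p^`()`_k.-1) = p`_k *+ k.
Proof. by case: k => [|k]; rewrite ?mulr0n // coef_deriv. Qed.

Section MatrixPolynomials.

Local Open Scope complex_scope.
Local Open Scope sesquilinear_scope.

Variables (R : realType) (N : nat).
Local Notation mx := 'M[R[i]]_N.+1.
Local Notation mpoly := {poly mx}.

(** Integrals and derivatives of matrices are formed from real and imaginary parts of entries. Both
    are functionals of this kind, so each transfer from scalars to matrices is proved once for all
    of them. *)
Definition real_linear (f : mx -> R) : Prop :=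
  forall c A B, f (c%:C *: A + B) = c * f A + f B.

Lemma real_linear0 f : real_linear f -> f 0 = 0.
Proof.
by move=> /(_ (-1) 0 0); rewrite scaler0 addr0 mulN1r => /eqP; rewrite addrC subrr => /eqP.
Qed.

Lemma real_linearZ f c A : real_linear f -> f (c%:C *: A) = c * f A.
Proof. by move=> fl; rewrite -[X in f X]addr0 fl real_linear0 // addr0. Qed.

Lemma real_linearD f A B : real_linear f -> f (A + B) = f A + f B.
Proof. by move=> /(_ 1 A B); rewrite scale1r mul1r. Qed.

Lemma real_linear_sum f (I : Type) (r : seq I) (F : I -> mx) : real_linear f ->
  f (\sum_(k <- r) F k) = \sum_(k <- r) f (F k).
Proof.
move=> fl; elim: r => [|k r IH]; first by rewrite !big_nil real_linear0.
by rewrite !big_cons real_linearD // IH.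
Qed.

Lemma real_linear_Re (p q : 'I_N.+1) : real_linear (fun A => complex.Re (A p q)).
Proof.
by move=> c A B; rewrite !mxE; case: (A p q) (B p q) => ? ? [? ?] /=; rewrite mul0r subr0.
Qed.

Lemma real_linear_Im (p q : 'I_N.+1) : real_linear (fun A => complex.Im (A p q)).
Proof.
by move=> c A B; rewrite !mxE; case: (A p q) (B p q) => ? ? [? ?] /=; rewrite mul0r addr0.
Qed.

Lemma mpevalE (X : mpoly) (y : R) :
  mpeval X y = \sum_(k < size X) (y ^+ k)%:C *: X`_k.
Proof.
rewrite /mpeval horner_coef; apply: eq_bigr => k _.
by rewrite -rmorphXn /= -rmorphXn /= -mulmxE mul_mx_scalar.
Qed.

Lemma mpevalM (X Y : mpoly) (y : R) : mpeval (X * Y) y = mpeval X y * mpeval Y y.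
Proof. by rewrite /mpeval hornerM_comm // /comm_poly -!mulmxE scalar_mxC. Qed.

Lemma real_linear_mpeval f (X : mpoly) (y : R) : real_linear f ->
  f (mpeval X y) = (map_poly f X).[y].
Proof.
move=> fl; rewrite mpevalE real_linear_sum // (@horner_coef_wide _ (size X)) ?size_poly //.
apply: eq_bigr => k _; rewrite coef_map_id0 ?real_linear0 //.
by rewrite real_linearZ // mulrC.
Qed.

(** The numbers [a] and [b] enter as scalar matrices because [{poly mx}] is scaled by its own
    coefficient ring. *)
Definition mdelta (a b : R) (X : mpoly) : mpoly :=
  'X * (1 - 'X) * X^`() + ((a%:C)%:M *: (1 - 'X) - (b%:C)%:M *: 'X) * X.

Lemma coef_mdelta (a b : R) (X : mpoly) k :
  (mdelta a b X)`_k = (k%:R + a)%:C *: X`_k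
    - (if k is k'.+1 then (k'%:R + a + b)%:C *: X`_k' else 0).
Proof.
rewrite /mdelta mulrBr mulr1 !mulrBl -mulrA scalerBr -addrA !mulrBl -!scalerAl mul1r.
rewrite !(coefD, coefN, coefZ, coefXM) /=.
case: k => [|k] /=.
  by rewrite !(mulr0, subr0, oppr0, mulr0n, add0r) -mulmxE mul_scalar_mx addr0.
have sM c (A : mx) : c%:M * A = c *: A by rewrite -mulmxE mul_scalar_mx.
rewrite !sM !rmorphD /= !rmorph_nat coefX_deriv coef_deriv; apply/matrixP => p q.
by rewrite !(mxE, mulmxnE) -(mulr_natl (X`_k.+1 p q)) -(mulr_natl (X`_k p q)); ring.
Qed.

Lemma coef_delta (a b : R) (p : {poly R}) k :
  (delta a b p)`_k = (k%:R + a) * p`_k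
    - (if k is k'.+1 then (k'%:R + a + b) * p`_k' else 0).
Proof.
rewrite /delta mulrBr mulr1 !mulrBl -mulrA scalerBr -addrA !mulrBl -!scalerAl mul1r.
rewrite !(coefD, coefN, coefZ, coefXM) /=.
case: k => [|k] /=; first by ring.
by rewrite coefX_deriv coef_deriv -(mulr_natl p`_k.+1) -(mulr_natl p`_k); ring.
Qed.

(** The coefficient formulas of [mdelta] and [delta] agree and contain only real factors, which [f]
    respects. *)
Lemma map_poly_mdelta f (a b : R) (X : mpoly) : real_linear f ->
  map_poly f (mdelta a b X) = delta a b (map_poly f X).
Proof.
move=> fl; apply/polyP => k.
rewrite coef_map_id0 ?real_linear0 // coef_delta coef_mdelta.
case: k => [|k]; rewrite ?subr0 ?real_linearZ // coef_map_id0 ?real_linear0 //.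
rewrite addrC -scaleNr -rmorphN fl /= real_linearZ // coef_map_id0 ?real_linear0 //.
by rewrite addrC mulNr.
Qed.

End MatrixPolynomials.

(** * Moments, integrals and derivatives of weighted matrix polynomials *)

Lemma wint_shift (R : realType) (a b : R) (p : {poly R}) :
  wint a b ('X * (1 - 'X) * p) = wint (a + 1) (b + 1) p.
Proof.
apply: eq_Rintegral => t; rewrite inE /= in_itv /= => /andP[t0 t1].
have t1' : 0 < 1 - t by rewrite subr_gt0.
rewrite /wgt !hornerE !powRD ?(gt_eqF t0) ?(gt_eqF t1') ?implybT //.
by rewrite !powRr1 ?ltW //=; ring.
Qed.

Lemma wint_poly (R : realType) (a b : R) n (c : nat -> R) : 0 <= a -> 0 <= b ->
  wint a b (\poly_(k < n) c k) = \sum_(k < n) c k * wint a b 'X^k.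
Proof.
move=> a0 b0; rewrite poly_def; elim: n => [|n IH].
  by rewrite !big_ord0 -(scale0r 0) wintZ // mul0r.
by rewrite !big_ord_recr /= wintD // IH wintZ.
Qed.

Section Moments.

Local Open Scope complex_scope.
Local Open Scope sesquilinear_scope.

Variables (R : realType) (N : nat).
Local Notation mx := 'M[R[i]]_N.+1.
Local Notation mpoly := {poly mx}.

Lemma adjmxD (A B : mx) : (A + B)^t* = A^t* + B^t*.
Proof. by rewrite linearD /= map_mxD. Qed.

Lemma adjmxN (A : mx) : (- A)^t* = - A^t*.
Proof. by rewrite linearN /= map_mxN. Qed.

Lemma adjmx0 : (0 : mx)^t* = 0.
Proof. by rewrite linear0 /= map_mx0. Qed.

Lemma adjmxM (A B : mx) : (A * B)^t* = B^t* * A^t*.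
Proof. by rewrite -!mulmxE trmx_mul map_mxM. Qed.

Lemma adjmxZ (c : R) (A : mx) : (c%:C *: A)^t* = c%:C *: A^t*.
Proof. by rewrite linearZ /= map_mxZ; congr (_ *: _); exact: conjc_real. Qed.

Lemma adjmx_sum (I : Type) (r : seq I) (F : I -> mx) :
  (\sum_(k <- r) F k)^t* = \sum_(k <- r) (F k)^t*.
Proof.
elim: r => [|k r IH]; first by rewrite !big_nil adjmx0.
by rewrite !big_cons adjmxD IH.
Qed.

Definition adjp (X : mpoly) : mpoly := map_poly (fun A : mx => A^t*) X.

Lemma coef_adjp (X : mpoly) k : (adjp X)`_k = (X`_k)^t*.
Proof. by rewrite coef_map_id0 // adjmx0. Qed.

Lemma adjpD (X Y : mpoly) : adjp (X + Y) = adjp X + adjp Y.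
Proof. by apply/polyP => k; rewrite !(coef_adjp, coefD) adjmxD. Qed.

Lemma adjpN (X : mpoly) : adjp (- X) = - adjp X.
Proof. by apply/polyP => k; rewrite !(coef_adjp, coefN) adjmxN. Qed.

Lemma adjpM (X Y : mpoly) : adjp (X * Y) = adjp Y * adjp X.
Proof.
apply/polyP => k; rewrite coef_adjp coefM coefMr adjmx_sum.
by apply: eq_bigr => j _; rewrite adjmxM !coef_adjp.
Qed.

Lemma adjp0 : adjp 0 = 0.
Proof. by apply/polyP => k; rewrite coef_adjp !coef0 adjmx0. Qed.

Lemma adjpC (A : mx) : adjp A%:P = (A^t*)%:P.
Proof.
by apply/polyP => k; rewrite coef_adjp !coefC; case: (k == 0%N); rewrite ?adjmx0.
Qed.

Lemma adjmx_scalar (c : R) : ((c%:C)%:M : mx)^t* = (c%:C)%:M.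
Proof. by rewrite tr_scalar_mx map_scalar_mx /=; congr (_%:M); exact: conjc_real. Qed.

Lemma adjpX : adjp 'X = 'X.
Proof.
apply/polyP => k; rewrite coef_adjp !coefX; case: (k == 1%N); last exact: adjmx0.
exact: adjmx_scalar 1.
Qed.

Lemma adjpK (X : mpoly) : adjp (adjp X) = X.
Proof. by apply/polyP => k; rewrite !coef_adjp trmxCK. Qed.

Lemma adjp_deriv (X : mpoly) : adjp X^`() = (adjp X)^`().
Proof.
apply/polyP => k; rewrite coef_adjp !coef_deriv coef_adjp.
have h (A : mx) n : (A *+ n)^t* = A^t* *+ n.
  by elim: n => [|n IH]; rewrite ?mulr0n ?adjmx0 // !mulrS adjmxD IH.
exact: h.
Qed.

Lemma mpeval_adjp (X : mpoly) (y : R) : mpeval (adjp X) y = (mpeval X y)^t*.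
Proof.
rewrite !mpevalE adjmx_sum.
have -> : size (adjp X) = size X.
  apply/anti_leq; rewrite size_poly /= -{1}(adjpK X); exact: size_poly.
by apply: eq_bigr => k _; rewrite adjmxZ coef_adjp.
Qed.

(** The integral of [X] against [wgt a b], expressed by scalar moments so that linearity and
    multiplication by constant matrices are pure algebra. [mxintegral_wgt] identifies it with the
    analytic integral. *)
Definition mom (a b : R) (X : mpoly) : mx :=
  \sum_(k < size X) (wint a b 'X^k)%:C *: X`_k.

Lemma mom_wide n a b (X : mpoly) : (size X <= n)%N ->
  mom a b X = \sum_(k < n) (wint a b 'X^k)%:C *: X`_k.
Proof.
move=> le; rewrite /mom (big_ord_widen n (fun k => (wint a b 'X^k)%:C *: X`_k)) //.
rewrite big_mkcond /=; apply: eq_bigr => k _; case: ltnP => // h.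
by rewrite nth_default // scaler0.
Qed.

Lemma mom0 a b : mom a b 0 = 0.
Proof. by rewrite /mom size_poly0 big_ord0. Qed.

Lemma momD a b (X Y : mpoly) : mom a b (X + Y) = mom a b X + mom a b Y.
Proof.
pose n := maxn (size X) (size Y).
rewrite !(@mom_wide n) ?leq_maxl ?leq_maxr ?size_polyD // -big_split /=.
by apply: eq_bigr => k _; rewrite coefD scalerDr.
Qed.

Lemma momN a b (X : mpoly) : mom a b (- X) = - mom a b X.
Proof. by apply/eqP; rewrite -addr_eq0 -momD addNr mom0. Qed.

Lemma momMl a b (A : mx) (X : mpoly) : mom a b (A%:P * X) = A * mom a b X.
Proof.
rewrite !(@mom_wide (size X)) ?mulr_sumr //.
  by apply: eq_bigr => k _; rewrite coefCM scalerAr.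
by apply/leq_sizeP => j h; rewrite coefCM nth_default // mulr0.
Qed.

Lemma momMr a b (A : mx) (X : mpoly) : mom a b (X * A%:P) = mom a b X * A.
Proof.
rewrite !(@mom_wide (size X)) ?mulr_suml //.
  by apply: eq_bigr => k _; rewrite coefMC scalerAl.
by apply/leq_sizeP => j h; rewrite coefMC nth_default // mul0r.
Qed.

Lemma mom_adjp a b (X : mpoly) : mom a b (adjp X) = (mom a b X)^t*.
Proof.
rewrite (@mom_wide (size X)) ?size_poly // /mom adjmx_sum.
by apply: eq_bigr => k _; rewrite coef_adjp adjmxZ.
Qed.

Lemma real_linear_mom f a b (X : mpoly) : real_linear f -> 0 <= a -> 0 <= b ->
  f (mom a b X) = wint a b (map_poly f X).
Proof.
move=> fl a0 b0; rewrite wint_poly // real_linear_sum //.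
by apply: eq_bigr => k _; rewrite real_linearZ // mulrC.
Qed.

Lemma eq_real_linear (A B : mx) :
  (forall f, real_linear f -> f A = f B) -> A = B.
Proof.
move=> h; apply/matrixP => p q.
apply/eqP; rewrite eq_complex.
by rewrite (h _ (real_linear_Re p q)) (h _ (real_linear_Im p q)) !eqxx.
Qed.

Lemma mom_mdelta a b (X : mpoly) : 0 <= a -> 0 <= b ->
  mom a b (mdelta (a + 1) (b + 1) X) = 0.
Proof.
move=> a0 b0; apply: eq_real_linear => f fl.
by rewrite real_linear_mom // map_poly_mdelta // wint_delta // real_linear0.
Qed.

Lemma map_poly_X1X f (X : mpoly) : real_linear f ->
  map_poly f ('X * (1 - 'X) * X) = 'X * (1 - 'X) * map_poly f X.
Proof.
move=> fl; have fX Y : map_poly f ('X * Y) = 'X * map_poly f Y.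
  apply/polyP => k; rewrite coefXM !coef_map_id0 ?real_linear0 // coefXM.
  by case: (k == 0%N); rewrite ?real_linear0 // coef_map_id0 ?real_linear0.
have fB Y Z : map_poly f (Y - Z) = map_poly f Y - map_poly f Z.
  apply/polyP => k; rewrite coefB !coef_map_id0 ?real_linear0 // coefB.
  by rewrite real_linearD // -scaleN1r -(rmorphN1 (real_complex R)) real_linearZ // mulN1r.
by rewrite -!mulrA !mulrBl !mul1r fX fB fX.
Qed.

Lemma mom_shift a b (X : mpoly) : 0 <= a -> 0 <= b ->
  mom a b ('X * (1 - 'X) * X) = mom (a + 1) (b + 1) X.
Proof.
move=> a0 b0; apply: eq_real_linear => f fl.
by rewrite !real_linear_mom ?addr_ge0 // map_poly_X1X // wint_shift.
Qed.

Lemma mxintegral_wgt a b (F : R -> mx) (X : mpoly) : 0 <= a -> 0 <= b ->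
  (forall y : R, 0 < y < 1 -> F y = (wgt a b y)%:C *: mpeval X y) ->
  mxintegral `]0, 1[%classic F = mom a b X.
Proof.
move=> a0 b0 FE; have h f : real_linear f ->
    Rintegral (@lebesgue_measure R) `]0, 1[%classic (fun t => f (F t)) = f (mom a b X).
  move=> fl; rewrite real_linear_mom //; apply: eq_Rintegral => t.
  rewrite inE /= in_itv /= => ht.
  by rewrite FE // real_linearZ // real_linear_mpeval.
apply/matrixP => p q; rewrite mxE (h _ (real_linear_Re p q)) (h _ (real_linear_Im p q)).
by case: (mom a b X p q).
Qed.

Lemma inner_wgt a b (W : R -> mx) (M P Q : mpoly) : 0 <= a -> 0 <= b ->
  (forall y : R, 0 < y < 1 -> W y = (wgt a b y)%:C *: mpeval M y) ->
  inner W P Q = mom a b (P * M * adjp Q).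
Proof.
move=> a0 b0 WE; apply: mxintegral_wgt => // y hy.
by rewrite WE // -scalemxAr -scalemxAl !mpevalM mpeval_adjp !mulmxE.
Qed.

Lemma mxintegrable_wgt a b (F : R -> mx) (X : mpoly) : 0 <= a -> 0 <= b ->
  (forall y : R, 0 < y < 1 -> F y = (wgt a b y)%:C *: mpeval X y) ->
  mxintegrable_on `]0, 1[%classic F.
Proof.
move=> a0 b0 FE p q; have h f : real_linear f ->
    (@lebesgue_measure R).-integrable `]0, 1[%classic (fun t => (f (F t))%:E).
  move=> fl; have := wgt_integrable_oo (map_poly f X) a0 b0.
  apply: eq_integrable => // t; rewrite inE /= in_itv /= => ht.
  by rewrite FE // real_linearZ // real_linear_mpeval.
by split; [exact: h (real_linear_Re p q)|exact: h (real_linear_Im p q)].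
Qed.

Fixpoint mdeltan (k : nat) (a b : R) (X : mpoly) : mpoly :=
  if k is k'.+1 then mdelta (a - k'%:R) (b - k'%:R) (mdeltan k' a b X) else X.

Lemma map_poly_mdeltan f k a b (X : mpoly) : real_linear f ->
  map_poly f (mdeltan k a b X) = deltan k a b (map_poly f X).
Proof. by move=> fl; elim: k => //= k IH; rewrite map_poly_mdelta // IH. Qed.

Lemma near_derive1n (f g : R -> R) k : {in `]0, 1[, f =1 g} ->
  {in `]0, 1[, derive1n k f =1 derive1n k g}.
Proof.
move=> fg; elim: k => //= k IH y hy; rewrite !derive1E; apply: near_eq_derive.
have : \forall z \near y, z \in `]0, 1[ by exact: near_in_itvoo.
by apply: filterS => z /=; exact: IH.
Qed.

Lemma mxderiven_wgt k a b (F : R -> mx) (X : mpoly) :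
  (forall y : R, 0 < y < 1 -> F y = (wgt a b y)%:C *: mpeval X y) ->
  forall y : R, 0 < y < 1 ->
  mxderiven k F y = (wgt (a - k%:R) (b - k%:R) y)%:C *: mpeval (mdeltan k a b X) y.
Proof.
move=> FE y hy; have h f : real_linear f ->
    derive1n k (fun t => f (F t)) y
    = f ((wgt (a - k%:R) (b - k%:R) y)%:C *: mpeval (mdeltan k a b X) y).
  move=> fl; rewrite real_linearZ // real_linear_mpeval // map_poly_mdeltan //.
  rewrite -derive1n_wgt //; apply: near_derive1n; last by rewrite in_itv.
  move=> t; rewrite in_itv /= => ht.
  by rewrite FE // real_linearZ // real_linear_mpeval.
apply/matrixP => p q; rewrite mxE /cderiven.
rewrite (h _ (real_linear_Re p q)) (h _ (real_linear_Im p q)).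
by case: (_ p q).
Qed.

Lemma mxsmooth_wgt a b (F : R -> mx) (X : mpoly) :
  (forall y : R, 0 < y < 1 -> F y = (wgt a b y)%:C *: mpeval X y) ->
  mxsmooth_on `]0, 1[%classic F.
Proof.
move=> FE p q; have h f : real_linear f -> smooth_on `]0, 1[%classic (fun t => f (F t)).
  move=> fl k y /=; rewrite in_itv /= => hy.
  have := @derivable_derive1n_wgt R k a b y (map_poly f X) hy.
  apply: near_eq_derivable.
  have : \forall z \near y, z \in `]0, 1[ by apply: near_in_itvoo; rewrite in_itv.
  apply: filterS => z /= hz; apply: near_derive1n hz => t; rewrite in_itv /= => ht.
  by rewrite FE // real_linearZ // real_linear_mpeval.
by split; [exact: h (real_linear_Re p q)|exact: h (real_linear_Im p q)].
Qed.

End Moments.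

(** * Leibniz rules and symmetry of second-order operators *)

Section Operators.

Local Open Scope complex_scope.
Local Open Scope sesquilinear_scope.

Variables (R : realType) (N : nat).
Local Notation mx := 'M[R[i]]_N.+1.
Local Notation mpoly := {poly mx}.

(** The logarithmic derivative of [wgt a b], multiplied by y(1-y). It is central, having scalar
    coefficients. *)
Definition jacobi_s (a b : R) : mpoly := (a%:C)%:M *: (1 - 'X) - (b%:C)%:M *: 'X.

Lemma X1X_comm (Y : mpoly) : Y * ('X * (1 - 'X)) = 'X * (1 - 'X) * Y.
Proof.
have cX : GRing.comm Y 'X by exact: commr_polyX.
by apply: commrM => //; apply: commrB => //; exact: commr1.
Qed.

Lemma jacobi_s_comm a b (Y : mpoly) : Y * jacobi_s a b = jacobi_s a b * Y.
Proof.
have cX : GRing.comm Y 'X by exact: commr_polyX.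
have cs c (p : mpoly) : GRing.comm Y p -> GRing.comm Y ((c%:C)%:M *: p).
  rewrite -mul_polyC => h; apply: commrM => //; apply/polyP => k.
  by rewrite coefMC coefCM -!mulmxE scalar_mxC.
by apply: commrB; apply: cs => //; apply: commrB => //; exact: commr1.
Qed.

Lemma adjp_X1X : adjp ('X * (1 - 'X)) = 'X * (1 - 'X) :> mpoly.
Proof.
have adjp1 : adjp 1 = 1 :> mpoly by rewrite adjpC; congr (_%:P); exact: adjmx_scalar 1.
by rewrite adjpM adjpD adjpN adjpX adjp1 commr_polyX.
Qed.

Lemma adjp_jacobi_s a b : adjp (jacobi_s a b) = jacobi_s a b.
Proof.
have adjp1 : adjp 1 = 1 :> mpoly by rewrite adjpC; congr (_%:P); exact: adjmx_scalar 1.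
have cs c (p : mpoly) : adjp ((c%:C)%:M *: p) = (c%:C)%:M *: adjp p.
  apply/polyP => k; rewrite coef_adjp !coefZ coef_adjp adjmxM adjmx_scalar.
  by rewrite -!mulmxE scalar_mxC.
by rewrite /jacobi_s adjpD adjpN !cs adjpD adjpN adjpX adjp1.
Qed.

Lemma mdeltaM a b (X Y : mpoly) :
  mdelta a b (X * Y) = mdelta a b X * Y + 'X * (1 - 'X) * (X * Y^`()).
Proof.
rewrite /mdelta derivM -/(jacobi_s a b); move: ('X * (1 - 'X)) => f.
move: (jacobi_s a b) => s; by rewrite mulrDr mulrDl !mulrA addrAC.
Qed.

Lemma mdeltaMl a b (X Y : mpoly) :
  mdelta a b (X * Y) = 'X * (1 - 'X) * (X^`() * Y) + X * mdelta a b Y.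
Proof.
rewrite /mdelta derivM -/(jacobi_s a b); have := X1X_comm X.
move: ('X * (1 - 'X)) => f fC; rewrite !mulrDr -addrA; congr (_ + _).
by rewrite !mulrA fC jacobi_s_comm.
Qed.

(* An identity between sums of monomials in a noncommutative ring is an
   identity of additive groups, which can be read off entry by entry in a
   commutative ring. *)
Ltac abel := apply/polyP => ?; rewrite ?(coefD, coefN, coef0);
  apply/matrixP => ? ?; rewrite ?(mxE); ring.

(** The two equations are the symmetry equations integrated once. The self-adjoint part of [F1 * M]
    is [mdelta] of [M], its anti-self-adjoint part is y(1-y) [Z], and [F0 * M - M * adjp F0] is
    [mdelta] of the constant [Z]. *)
Lemma diffop_symmetric a b (M F1 F0 : mpoly) (Z : mx) (P Q : mpoly) :
  0 <= a -> 0 <= b -> adjp M = M -> Z^t* = - Z ->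
  F1 * M = 'X * (1 - 'X) * M^`() + jacobi_s (a + 1) (b + 1) * M + 'X * (1 - 'X) * Z%:P ->
  F0 * M - M * adjp F0 = jacobi_s (a + 1) (b + 1) * Z%:P ->
  mom a b (diffop_app P (DiffOp ('X * (1 - 'X)) F1 F0) * M * adjp Q)
  = mom a b (P * M * adjp (diffop_app Q (DiffOp ('X * (1 - 'X)) F1 F0))).
Proof.
move=> a0 b0 aM aZ h1 h0; apply/eqP; rewrite -subr_eq0 -momN -momD; apply/eqP.
rewrite -[RHS](mom_mdelta
  (P^`() * M * adjp Q - P * M * (adjp Q)^`() + P * Z%:P * adjp Q) a0 b0).
congr (mom a b _); rewrite /mdelta -/(jacobi_s _ _) /diffop_app /=.
have := adjp_jacobi_s (a + 1) (b + 1); have := jacobi_s_comm (a + 1) (b + 1).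
have := adjp_X1X; have := X1X_comm.
move: ('X * (1 - 'X)) (jacobi_s _ _) h1 h0 => f s h1 h0 fC af sC sadj.
(* The adjoint of the first-order equation; the sign of [Z] flips. *)
have h1' : M * adjp F1 = f * M^`() + s * M - f * Z%:P.
  have := congr1 (@adjp R N) h1; rewrite !adjpD !adjpM aM adjp_deriv aM => ->.
  by rewrite af sadj adjpC aZ polyCN !fC sC mulrN.
have h0' : F0 * M = M * adjp F0 + s * Z%:P by rewrite -h0 addrC subrK.
rewrite !adjpD !adjpM !adjp_deriv af.
set Q0 := adjp Q; set Q1 := Q0^`(); set Q2 := Q1^`().
set P1 := P^`(); set P2 := P1^`().
rewrite !derivD derivN !derivM derivC -/P1 -/P2 -/Q1 -/Q2 mulr0 addr0.
(* The coefficients [F1], [F0] and their adjoints are eliminated, and the central factors [f], [s]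
   are pulled to the left. What remains is an equality of sums of monomials. *)
rewrite !mulrDl -(mulrA P1 F1) h1 -(mulrA P F0) h0'.
rewrite !mulrDr -!mulrA (mulrA M (adjp F1)) h1'.
rewrite !(mulrDl, mulrDr, mulrN, mulNr) !mulrA !(fC, sC) !mulrA.
rewrite ?(fC, sC) ?mulrA.
abel.
Qed.

End Operators.

(** * Orthogonal polynomials from an abstract raising operator *)

Lemma mxmuln_eq0 (K : numDomainType) p q (X : 'M[K]_(p, q)) n :
  (X *+ n == 0) = (X == 0) || (n == 0%N).
Proof.
apply/eqP/orP => [h|[/eqP ->|/eqP ->]]; rewrite ?mul0rn ?mulr0n //.
have [_|n0] := eqVneq n 0%N; [by right|left].
apply/eqP/matrixP => u v; apply/eqP; move/matrixP/(_ u v)/eqP: h.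
by rewrite mulmxnE !mxE mulrn_eq0 (negbTE n0).
Qed.

Section RaisingOperator.

Local Open Scope complex_scope.
Local Open Scope sesquilinear_scope.

Variables (R : realType) (N : nat) (a b : R).
Local Notation mx := 'M[R[i]]_N.+1.
Local Notation mpoly := {poly mx}.

Variables M Phi A : nat -> mpoly.
Implicit Types P Q T : mpoly.

Hypothesis a_ge0 : 0 <= a.
Hypothesis b_ge0 : 0 <= b.
Hypothesis adjM : forall j, adjp (M j) = M j.
Hypothesis PhiM : forall j, 'X * (1 - 'X) * M j.+1 = Phi j * M j.
Hypothesis AM : forall j,
  mdelta (a + j.+1%:R) (b + j.+1%:R) (M j.+1) = A j * M j.
Hypothesis size_Phi : forall j, (size (Phi j) <= 3)%N.
Hypothesis size_A : forall j, (size (A j) <= 2)%N.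
Hypothesis lead_unit : forall j d,
  (Phi j)`_2 *+ d + (A j)`_1 \is a GRing.unit.
Hypothesis mom_unit : forall j,
  mom (a + j%:R) (b + j%:R) (M j) \is a GRing.unit.

(** The index [j] stands for the parameter kappa + j, so this is the inner product of the j-th
    weight in algebraic form. *)
Definition ip j (P Q : mpoly) : mx :=
  mom (a + j%:R) (b + j%:R) (P * M j * adjp Q).

Definition raise j (P : mpoly) : mpoly := P^`() * Phi j + P * A j.

Fixpoint rod j d : mpoly := if d is d'.+1 then raise j (rod j.+1 d') else 1.

Definition mop j d : mpoly := ((rod j d)`_d)^-1%:P * rod j d.

(** In the Leibniz rule for [P * M j.+1], [PhiM] trades [M j.+1] for [M j] in the term with the
    derivative of [P], and [AM] does so in the other term. *)
Lemma raise_weight j P :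
  raise j P * M j = mdelta (a + j.+1%:R) (b + j.+1%:R) (P * M j.+1).
Proof.
rewrite mdeltaMl AM /raise mulrDl -!mulrA -PhiM; congr (_ + _).
by rewrite !mulrA; congr (_ * _); rewrite -!mulrA X1X_comm mulrA.
Qed.

Lemma rod_weight j d :
  mdeltan d (a + (j + d)%:R) (b + (j + d)%:R) (M (j + d)) = rod j d * M j.
Proof.
elim: d j => [|d IH] j; first by rewrite addn0 mul1r.
rewrite [rod _ _]/= raise_weight -IH addSnnS /=.
(* The outermost [mdelta] has first parameter a + (j + d + 1) - d, which is a + j + 1; likewise for
   [b]. *)
by rewrite -addSnnS natrD !addrA !addrK.
Qed.

(** Integration by parts: the factor y(1-y) brings the inner product of index [j.+1] to the weight
    of index [j], and the two terms then add up to the integral of [mdelta] of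
    [P * M j.+1 * adjp Q]. *)
Lemma ip_raise j P Q : ip j (raise j P) Q = - ip j.+1 P Q^`().
Proof.
have h c : c + j.+1%:R = c + j%:R + 1 :> R by rewrite -natr1 addrA.
apply/eqP; rewrite -addr_eq0 /ip raise_weight !h -mom_shift ?addr_ge0 // -momD.
by rewrite adjp_deriv -mdeltaM mom_mdelta ?addr_ge0.
Qed.

Lemma ip_rod j d Q : ip j (rod j d) Q = (-1) ^+ d * ip (j + d) 1 Q^`(d).
Proof.
elim: d j Q => [|d IH] j Q; first by rewrite addn0 expr0 mul1r.
by rewrite [rod _ _]/= ip_raise IH -derivSn exprS mulN1r mulNr addSnnS.
Qed.

Lemma ip_adj j P Q : (ip j P Q)^t* = ip j Q P.
Proof. by rewrite /ip -mom_adjp !adjpM adjpK adjM mulrA. Qed.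

Lemma ipDl j P P' Q : ip j (P + P') Q = ip j P Q + ip j P' Q.
Proof. by rewrite /ip !mulrDl momD. Qed.

Lemma ipDr j P Q Q' : ip j P (Q + Q') = ip j P Q + ip j P Q'.
Proof. by rewrite /ip adjpD mulrDr momD. Qed.

Lemma ipNr j P Q : ip j P (- Q) = - ip j P Q.
Proof. by rewrite /ip adjpN mulrN momN. Qed.

Lemma ipCl j (c : mx) P Q : ip j (c%:P * P) Q = c * ip j P Q.
Proof. by rewrite /ip -!mulrA momMl. Qed.

Lemma size_raise j P d : (size P <= d.+1)%N -> (size (raise j P) <= d.+2)%N.
Proof.
move=> sP; apply/leq_sizeP => k hk; rewrite coefD !coefM.
rewrite !big1 ?addr0 // => -[l /= hl] _.
- have [h|h] := leqP 2 (k - l)%N.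
    by rewrite [(A j)`_ _]nth_default ?mulr0 // (leq_trans (size_A j)).
  by rewrite [P`_ _]nth_default ?mul0r // (leq_trans sP) //; lia.
- have [h|h] := leqP 3 (k - l)%N.
    by rewrite [(Phi j)`_ _]nth_default ?mulr0 // (leq_trans (size_Phi j)).
  rewrite coef_deriv [P`_ _]nth_default ?mul0rn ?mul0r // (leq_trans sP) //; lia.
Qed.

Lemma coef_raise j P d : (size P <= d.+1)%N ->
  (raise j P)`_d.+1 = P`_d * ((Phi j)`_2 *+ d + (A j)`_1).
Proof.
move=> sP; rewrite coefD !coefM mulrDr; congr (_ + _).
  (* For [d = 0] the derivative of [P] vanishes. Otherwise only the product of the two top
     coefficients survives in the convolution. *)
  case: d sP => [|d] sP.
    rewrite mulr0n mulr0 big1 // => -[l /= hl] _.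
    by rewrite coef_deriv [P`_ _]nth_default ?mul0rn ?mul0r // (leq_trans sP).
  have dlt : (d < d.+3)%N by lia.
  rewrite (bigD1 (Ordinal dlt)) //= big1 ?addr0.
    by rewrite coef_deriv (_ : d.+2 - d = 2)%N ?mulrnAl ?mulrnAr //; lia.
  move=> [l /= hl] /eqP ne.
  have {}ne : l != d by apply/eqP => h; apply: ne; apply/val_inj.
  have [h|h] := leqP d.+1 l.
    by rewrite coef_deriv [P`_ _]nth_default ?mul0rn ?mul0r // (leq_trans sP).
  rewrite [(Phi j)`_ _]nth_default ?mulr0 // (leq_trans (size_Phi j)) //; lia.
have dlt : (d < d.+2)%N by lia.
rewrite (bigD1 (Ordinal dlt)) //= big1 ?addr0.
  by rewrite (_ : d.+1 - d = 1)%N //; lia.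
move=> [l /= hl] /eqP ne.
have {}ne : l != d by apply/eqP => h; apply: ne; apply/val_inj.
have [h|h] := leqP d.+1 l.
  by rewrite [P`_ _]nth_default ?mul0r // (leq_trans sP).
rewrite [(A j)`_ _]nth_default ?mulr0 // (leq_trans (size_A j)) //; lia.
Qed.

Lemma size_rod j d : (size (rod j d) <= d.+1)%N.
Proof.
elim: d j => [|d IH] j; first by rewrite size_poly1.
exact: size_raise.
Qed.

Lemma rod_lead_unit j d : (rod j d)`_d \is a GRing.unit.
Proof.
elim: d j => [|d IH] j; first by rewrite coef1 unitr1.
rewrite [rod _ _]/= coef_raise ?size_rod // unitrMl //.
Qed.

Lemma mop_lead j d : (mop j d)`_d = 1.
Proof. by rewrite coefCM mulVr // rod_lead_unit. Qed.

Lemma size_mop j d : size (mop j d) = d.+1.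
Proof.
apply/eqP; rewrite eqn_leq; apply/andP; split.
  apply/leq_sizeP => k hk.
  by rewrite coefCM [(rod j d)`_k]nth_default ?mulr0 // (leq_trans (size_rod j d)).
by rewrite ltnNge; apply/negP => /leq_sizeP /(_ d (leqnn d)) /eqP; rewrite mop_lead oner_eq0.
Qed.

Lemma mop_monic j d : mop j d \is monic.
Proof. by rewrite monicE /lead_coef size_mop mop_lead. Qed.

Lemma derivn_small (P : mpoly) d : (size P <= d)%N -> P^`(d) = 0.
Proof.
move=> sP; apply/polyP => k; rewrite coef_derivn coef0 nth_default ?mul0rn //.
by rewrite (leq_trans sP) // leq_addr.
Qed.

(** After [d] integrations by parts only the d-th derivative of [Q] is left, which is zero. *)
Lemma ip_mop j d Q : (size Q <= d)%N -> ip j (mop j d) Q = 0.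
Proof.
move=> sQ; rewrite /mop ipCl ip_rod derivn_small //.
by rewrite /ip adjp0 mulr0 mom0 !mulr0.
Qed.

(** If [D] had degree [e], pairing it with [rod j e] would differentiate it down to e! times its
    leading coefficient. This leaves the total mass of the weight of index [j + e] times the adjoint
    of that constant, and the mass is invertible. *)
Lemma ip_nondegenerate j d (D : mpoly) : (size D <= d)%N ->
  (forall T, (size T <= d)%N -> ip j T D = 0) -> D = 0.
Proof.
move=> sD hD; apply/eqP; apply: contraT => D0.
have sD0 : (0 < size D)%N by rewrite lt0n size_poly_eq0.
pose e := (size D).-1; have se : size D = e.+1 by rewrite /e prednK.
have De : D^`(e) = (D`_e *+ e`!)%:P.
  apply/polyP => k; rewrite coef_derivn coefC.
  case: k => [|k]; first by rewrite addn0 ffactnn.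
  by rewrite nth_default ?mul0rn // se addnS ltnS leq_addr.
have sR : (size (rod j e) <= d)%N by rewrite (leq_trans (size_rod j e)) -?se.
have h1 : ip (j + e) 1 D^`(e) = 0.
  by apply: (mulrI (unitrX e (unitrN1 _))); rewrite mulr0 -ip_rod hD.
have h2 : (D`_e *+ e`!)^t* = 0.
  by apply: (mulrI (mom_unit (j + e))); rewrite mulr0 -momMr -adjpC -De -[RHS]h1 /ip mul1r.
have /eqP : D`_e *+ e`! = 0 by rewrite -[LHS]trmxCK h2 adjmx0.
by rewrite mxmuln_eq0 (negbTE (lt0n_neq0 (fact_gt0 e))) orbF lead_coef_eq0 (negbTE D0).
Qed.

(** The difference of two monic polynomials of degree [d] has lower degree and is still orthogonal
    to all lower degrees, so nondegeneracy kills it. *)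
Lemma mop_unique j d Q : size Q = d.+1 -> Q \is monic ->
  (forall T, (size T <= d)%N -> ip j T Q = 0) -> Q = mop j d.
Proof.
move=> sQ mQ hQ; apply/eqP; rewrite -subr_eq0; apply/eqP.
apply: (@ip_nondegenerate j d) => [|T sT].
  apply/leq_sizeP => k; rewrite leq_eqVlt => /orP[/eqP <-|hk].
    move: mQ; rewrite coefB mop_lead monicE /lead_coef sQ => /eqP ->.
    by rewrite subrr.
  by rewrite coefB !nth_default ?subrr // ?sQ ?size_mop.
by rewrite ipDr ipNr hQ // -ip_adj ip_mop // adjmx0 subrr.
Qed.

(** Lower-degree polynomials are left combinations of the [Q k] with [k < d]: the induction removes
    the top coefficient of [T] by subtracting a left multiple of [Q e]. *)
Lemma orthogonal_lower j (Q : nat -> mpoly) d :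
  (forall k, Q k \is monic /\ size (Q k) = k.+1) ->
  (forall k, (k < d)%N -> ip j (Q k) (Q d) = 0) ->
  forall T, (size T <= d)%N -> ip j T (Q d) = 0.
Proof.
move=> hQ ho; have h e : (e <= d)%N -> forall T, (size T <= e)%N -> ip j T (Q d) = 0.
  2: exact: h.
elim: e => [|e IH] he T sT.
  move: sT; rewrite leqn0 size_poly_eq0 => /eqP ->.
  by rewrite /ip !mul0r mom0.
have [mQ sQ] := hQ e; have ed : (e < d)%N by [].
rewrite -(subrK ((T`_e)%:P * Q e) T) ipDl ipCl ho // mulr0 addr0.
apply: IH; first exact: ltnW.
apply/leq_sizeP => k; rewrite leq_eqVlt coefB coefCM => /orP[/eqP <-|hk].
  by move: mQ; rewrite monicE /lead_coef sQ /= => /eqP ->; rewrite mulr1 subrr.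
by rewrite [T`_k]nth_default ?(leq_trans sT) // [(Q e)`_k]nth_default ?sQ // mulr0 subrr.
Qed.

Lemma orthogonal_mop j (Q : nat -> mpoly) :
  (forall k, Q k \is monic /\ size (Q k) = k.+1) ->
  (forall k l, k <> l -> ip j (Q k) (Q l) = 0) ->
  forall d, Q d = mop j d.
Proof.
move=> hQ ho d; have [mQ sQ] := hQ d; apply: mop_unique => //.
by apply: orthogonal_lower => // k kd; apply: ho => /eqP; rewrite ltn_eqF.
Qed.

Lemma mop_orthogonal j k l : k <> l -> ip j (mop j k) (mop j l) = 0.
Proof.
move=> /eqP; rewrite neq_ltn => /orP[h|h]; last by rewrite ip_mop // size_mop.
by rewrite -ip_adj ip_mop ?size_mop // adjmx0.
Qed.

(** Both sides have the same leading coefficient, so their difference has lower degree. Against a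
    test polynomial [T] the derivative moves to [raise j T], whose degree is still too small to pair
    nontrivially with [mop j d]. *)
Lemma mop_deriv j d : (mop j d)^`() = mop j.+1 d.-1 *+ d.
Proof.
case: d => [|d]; first by rewrite /mop mulr1 derivC mulr0n.
rewrite -mulr_natl -polyC_natr; apply/eqP; rewrite -subr_eq0 /=; apply/eqP.
apply: (@ip_nondegenerate j.+1 d) => [|T sT].
  apply/leq_sizeP => k; rewrite leq_eqVlt coefB coefCM coef_deriv => /orP[/eqP <-|hk].
    by rewrite !mop_lead mulr1 subrr.
  by rewrite !nth_default ?mulr0 ?mul0rn ?subrr // ?size_mop.
rewrite ipDr ipNr.
have -> : ip j.+1 T (d.+1%:R%:P * mop j.+1 d) = 0.
  by rewrite -ip_adj ipCl ip_mop // mulr0 adjmx0.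
rewrite subr0 -[LHS]opprK -ip_raise -ip_adj ip_mop ?adjmx0 ?oppr0 //.
(* [size_raise] takes a bound of the form [d.+1]; for [d = 0] the test polynomial is zero. *)
case: d sT => [|d]; last exact: size_raise.
by rewrite leqn0 size_poly_eq0 => /eqP ->; rewrite /raise deriv0 !mul0r addr0 size_poly0.
Qed.

End RaisingOperator.

(** * Two-by-two matrices and quadratic matrix polynomials with real coefficients *)

Section RealQuadratic.

Local Open Scope complex_scope.
Local Open Scope sesquilinear_scope.

Lemma mx2P (T : Type) (A : 'M[T]_2) : A = mx2 (A 0 0) (A 0 1) (A 1 0) (A 1 1).
Proof.
by apply/matrixP => -[[|[|//]] p] [[|[|//]] q]; rewrite !mxE /=; congr (A _ _); apply/val_inj.
Qed.

Lemma mx2D (K : comNzRingType) (a b c d a' b' c' d' : K) :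
  mx2 a b c d + mx2 a' b' c' d' = mx2 (a + a') (b + b') (c + c') (d + d').
Proof. by rewrite [LHS]mx2P !mxE. Qed.

Lemma mx2N (K : comNzRingType) (a b c d : K) :
  - mx2 a b c d = mx2 (- a) (- b) (- c) (- d).
Proof. by rewrite [LHS]mx2P !mxE. Qed.

Lemma mx2Z (K : comNzRingType) (x a b c d : K) :
  x *: mx2 a b c d = mx2 (x * a) (x * b) (x * c) (x * d).
Proof. by rewrite [LHS]mx2P !mxE. Qed.

Lemma mx2M (K : comNzRingType) (a b c d a' b' c' d' : K) :
  mx2 a b c d *m mx2 a' b' c' d'
  = mx2 (a * a' + b * c') (a * b' + b * d') (c * a' + d * c') (c * b' + d * d').
Proof. by rewrite [LHS]mx2P !mxE !big_ord_recl !big_ord0 !mxE !addr0. Qed.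

Lemma mx2T (K : comNzRingType) (a b c d : K) : (mx2 a b c d)^T = mx2 a c b d.
Proof. by rewrite [LHS]mx2P !mxE. Qed.

Lemma mx2_scalar (K : comNzRingType) (a : K) : a%:M = mx2 a 0 0 a.
Proof. by rewrite [LHS]mx2P !mxE. Qed.

Lemma map_mx2 (K L : comNzRingType) (f : K -> L) (a b c d : K) :
  map_mx f (mx2 a b c d) = mx2 (f a) (f b) (f c) (f d).
Proof. by rewrite [LHS]mx2P !mxE. Qed.

Lemma mx2_unit (K : fieldType) (a b c d : K) :
  a * d - b * c != 0 -> mx2 a b c d \in unitmx.
Proof.
move=> h; pose e := a * d - b * c.
apply: (proj1 (@mulmx1_unit _ _ _ (e^-1 *: mx2 d (- b) (- c) a) _)).
by rewrite -scalemxAr mx2M mx2Z mx2_scalar; congr mx2; rewrite /e; field.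
Qed.

Variable R : realType.
Local Notation mx := 'M[R[i]]_2.
Local Notation mpoly := {poly mx}.

(** All data of the family are real, so matrix identities are checked over [R] and transported by
    this embedding. *)
Definition rmx (A : 'M[R]_2) : mx := map_mx (real_complex R) A.

Lemma rmxD A B : rmx (A + B) = rmx A + rmx B.
Proof. exact: map_mxD. Qed.

Lemma rmxN A : rmx (- A) = - rmx A.
Proof. exact: map_mxN. Qed.

Lemma rmxM A B : rmx (A *m B) = rmx A * rmx B.
Proof. exact: map_mxM. Qed.

Lemma rmxZ c A : rmx (c *: A) = c%:C *: rmx A.
Proof. exact: map_mxZ. Qed.

Lemma rmx_scalar c : rmx c%:M = (c%:C)%:M.
Proof. exact: map_scalar_mx. Qed.

Lemma adj_rmx A : (rmx A)^t* = rmx A^T.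
Proof. by apply/matrixP => p q; rewrite !mxE; exact: conjc_real. Qed.

Lemma rmx_unit A : A \in unitmx -> rmx A \is a GRing.unit.
Proof. by move=> h; rewrite -[_ \is a _]/(rmx A \in unitmx) map_unitmx. Qed.

Definition qpoly (A0 A1 A2 : 'M[R]_2) : mpoly :=
  (rmx A0)%:P + (rmx A1)%:P * 'X + (rmx A2)%:P * 'X^2.

Lemma coef_qpoly A0 A1 A2 k :
  (qpoly A0 A1 A2)`_k = rmx (nth 0 [:: A0; A1; A2] k).
Proof.
rewrite /qpoly !(coefD, coefC, coefCM, coefX, coefXn).
case: k => [|[|[|k]]] /=; rewrite ?mulr0 ?mulr1 ?addr0 ?add0r //.
by rewrite nth_nil /rmx map_mx0.
Qed.

Lemma size_qpoly A0 A1 A2 : (size (qpoly A0 A1 A2) <= 3)%N.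
Proof.
apply/leq_sizeP => -[|[|[|k]]] // _.
by rewrite coef_qpoly /= nth_nil /rmx map_mx0.
Qed.

Lemma size_qpoly2 A0 A1 : (size (qpoly A0 A1 0) <= 2)%N.
Proof.
apply/leq_sizeP => -[|[|[|k]]] // _; rewrite coef_qpoly /= ?nth_nil /rmx map_mx0 //.
Qed.

Lemma adjp_qpoly A0 A1 A2 : adjp (qpoly A0 A1 A2) = qpoly A0^T A1^T A2^T.
Proof.
apply/polyP => k; rewrite coef_adjp !coef_qpoly adj_rmx; congr rmx.
by case: k => [|[|[|k]]] //=; rewrite !nth_nil trmx0.
Qed.

Lemma deriv_qpoly A0 A1 A2 : (qpoly A0 A1 A2)^`() = qpoly A1 (2 *: A2) 0.
Proof.
apply/polyP => k; rewrite coef_deriv !coef_qpoly.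
case: k => [|[|k]] //=; first by rewrite rmxZ rmorph_nat scaler_nat.
by rewrite nth_nil; case: k => [|k]; rewrite /= ?nth_nil /rmx map_mx0 mul0rn.
Qed.

Lemma mpeval_qpoly A0 A1 A2 y :
  mpeval (qpoly A0 A1 A2) y = rmx (A0 + y *: A1 + y ^+ 2 *: A2).
Proof.
rewrite /mpeval !(hornerD, hornerC, hornerMX) hornerCM hornerXn.
rewrite !rmxD !rmxZ -rmorphXn /= -rmorphXn /=.
by rewrite -!mulmxE !mul_mx_scalar.
Qed.

Lemma mpevalD N (X Y : {poly 'M[R[i]]_N.+1}) y :
  mpeval (X + Y) y = mpeval X y + mpeval Y y.
Proof. exact: hornerD. Qed.

Lemma mpevalN N (X : {poly 'M[R[i]]_N.+1}) y : mpeval (- X) y = - mpeval X y.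
Proof. exact: hornerN. Qed.

Lemma mpevalC N (A : 'M[R[i]]_N.+1) y : mpeval A%:P y = A.
Proof. exact: hornerC. Qed.

Lemma mpevalX N y : mpeval ('X : {poly 'M[R[i]]_N.+1}) y = (y%:C)%:M.
Proof. exact: hornerX. Qed.

Lemma mpeval_inj (X Y : mpoly) : (forall y : R, mpeval X y = mpeval Y y) -> X = Y.
Proof.
move=> h; apply/polyP => k; apply: eq_real_linear => f fl.
suff e : map_poly f X = map_poly f Y.
  by move/polyP/(_ k): e; rewrite !coef_map_id0 ?real_linear0.
apply/eqP; rewrite -subr_eq0; apply: contraT => nz.
(* The natural numbers below the size are distinct in [R], which gives more roots than the degree
   allows. *)
pose s := [seq k%:R : R | k <- iota 0 (size (map_poly f X - map_poly f Y))].
have := @max_poly_roots _ _ s nz; rewrite size_map size_iota ltnn => -> //.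
  apply/allP => z _; rewrite rootE hornerD hornerN -!real_linear_mpeval // h subrr //.
by rewrite map_inj_uniq ?iota_uniq // => u v /eqP; rewrite eqr_nat => /eqP.
Qed.

End RealQuadratic.

(** * The polynomial data of the family and their rational identities *)

Section Family.

Local Open Scope complex_scope.
Local Open Scope sesquilinear_scope.

Variables (R : realType) (n m i : R).

(** The parameters are real numbers here, so that the identities below are rational ones. Up to the
    power of y, the lower right entry of [Psi0] is [fam_g0 + fam_g1 * y]; [fam_t] is the lower right
    entry of [Tmx]. *)
Definition fam_nu := n - i.
Definition fam_q := m + 1 + fam_nu.
Definition fam_g0 := - (m + 1) / fam_nu.
Definition fam_g1 := fam_q / fam_nu.
Definition fam_t (k : R) := fam_nu / (i + k).

(* [y e e^T + t u u^T] with [e = (1, 1)], [u = (1, g0 + g1 y)], that is,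
   [Psi0 T Psi0^*] without the factor [y^m]. *)
Definition weight_poly (k : R) : {poly 'M[R[i]]_2} :=
  qpoly (mx2 (fam_t k) (fam_t k * fam_g0) (fam_t k * fam_g0) (fam_t k * fam_g0 ^+ 2))
        (mx2 1 (1 + fam_t k * fam_g1) (1 + fam_t k * fam_g1)
             (1 + 2 * fam_t k * fam_g0 * fam_g1))
        (mx2 0 0 0 (fam_t k * fam_g1 ^+ 2)).

(** With the columns e, u above, M_{k+1} M_k^{-1} fixes e and multiplies u by t_{k+1}/t_k =
    (i+k)/(i+k+1). As det(e,u) = -q(1-y)/nu, its only pole is at y = 1. Multiplied by y(1-y) it
    becomes y((1-y) I + c u (-1,1)), with (-1,1) a row. *)
Definition shift_poly (k : R) : {poly 'M[R[i]]_2} :=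
  let c := fam_nu / (fam_q * (i + k + 1)) in
  qpoly 0 (mx2 (1 - c) c (- c * fam_g0) (1 + c * fam_g0))
          (mx2 (-1) 0 (- c * fam_g1) (- 1 + c * fam_g1)).

(** The quotient of [mdelta] of M_{k+1} by M_k. Here [al] is the exponent of y and [L] the sum of
    both exponents in the weight of parameter [k + 1], while [r] is t_{k+1}/t_k. *)
Definition raise_poly (k : R) : {poly 'M[R[i]]_2} :=
  let s := i + k + 1 in
  let r := (i + k) / s in
  let al := m + k + 1 in
  let L := m + n + 2 * k + 1 in
  let A12 := fam_nu * (L + 1) / (fam_q * s) in
  qpoly (mx2 (al + 1 + fam_nu / s - A12) A12
             (al + 1 - (m + 1) / s + fam_nu / s - A12 - r * al)
             (A12 - fam_nu / s + r * al))
        (mx2 (- L - 1) 0 (- L - 1 + fam_q / s + r * (L + 2)) (- r * (L + 2)))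
        0.

End Family.

Section FamilyIdentities.

Local Open Scope complex_scope.
Local Open Scope sesquilinear_scope.

Lemma mpeval_X1X (R : realType) (y : R) :
  mpeval ('X * (1 - 'X) : {poly 'M[R[i]]_2}) y = rmx (y * (1 - y))%:M.
Proof.
rewrite mpevalM mpevalD mpevalN mpevalX mpevalC scalar_mxM rmxM raddfB /= rmxD rmxN !rmx_scalar.
by rewrite rmorph1.
Qed.

Lemma mpeval_jacobi_s (R : realType) (a b y : R) :
  mpeval (jacobi_s 1 a b) y = rmx (a * (1 - y) - b * y)%:M.
Proof.
rewrite /jacobi_s mpevalD mpevalN -!mul_polyC !mpevalM !mpevalC mpevalD mpevalN mpevalX mpevalC.
rewrite raddfB /= !scalar_mxM raddfB /= rmxD rmxN !rmxM rmxD rmxN !rmx_scalar.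
by rewrite rmorph1.
Qed.

Lemma adjp_weight_poly (R : realType) (n m i k : R) :
  adjp (weight_poly n m i k) = weight_poly n m i k.
Proof. by rewrite adjp_qpoly !mx2T. Qed.

Lemma fam_q_gt0 (R : realType) (n m i : R) : 0 <= m -> i < n -> 0 < m + 1 + (n - i).
Proof. lra. Qed.

Lemma X1X_weight_poly (R : realType) (n m i k : R) : 0 < i -> i < n -> 0 <= m -> 0 <= k ->
  'X * (1 - 'X) * weight_poly n m i (k + 1) = shift_poly n m i k * weight_poly n m i k.
Proof.
move=> i0 ni m0 k0; have ik : i + k != 0 by rewrite gt_eqF //; lra.
have ik1 : i + (k + 1) != 0 by rewrite gt_eqF //; lra.
have ik1' : i + k + 1 != 0 by rewrite gt_eqF //; lra.
have nu0 : n - i != 0 by rewrite subr_eq0 gt_eqF.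
have q0 := lt0r_neq0 (fam_q_gt0 m0 ni).
apply: mpeval_inj => y.
rewrite (mpevalM (_ * _)) mpeval_X1X mpevalM !mpeval_qpoly -!rmxM; congr rmx.
rewrite mx2_scalar add0r !(mx2Z, mx2D, mx2M) /fam_t /fam_g0 /fam_g1 /fam_q /fam_nu.
by congr mx2; field; rewrite ?nu0 ?q0 ?ik ?ik1 ?ik1'.
Qed.

Lemma mdelta_weight_poly (R : realType) (n m i k : R) : 0 < i -> i < n -> 0 <= m -> 0 <= k ->
  mdelta (m + k + 1) (n + k) (weight_poly n m i (k + 1))
  = raise_poly n m i k * weight_poly n m i k.
Proof.
move=> i0 ni m0 k0; have ik : i + k != 0 by rewrite gt_eqF //; lra.
have ik1 : i + (k + 1) != 0 by rewrite gt_eqF //; lra.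
have ik1' : i + k + 1 != 0 by rewrite gt_eqF //; lra.
have nu0 : n - i != 0 by rewrite subr_eq0 gt_eqF.
have q0 := lt0r_neq0 (fam_q_gt0 m0 ni).
apply: mpeval_inj => y; rewrite /mdelta -/(jacobi_s 1 _ _) deriv_qpoly mpevalD.
rewrite (mpevalM ('X * (1 - 'X))) mpeval_X1X !mpevalM mpeval_jacobi_s !mpeval_qpoly.
rewrite -!rmxM -rmxD; congr rmx.
rewrite !mx2_scalar !scaler0 !addr0 !(mx2Z, mx2D, mx2M) /fam_t /fam_g0 /fam_g1 /fam_q /fam_nu.
by congr mx2; field; rewrite ?nu0 ?q0 ?ik ?ik1 ?ik1'.
Qed.

(** Both leading coefficients are lower triangular. With L = m+n+2k+1 and r = (i+k)/(i+k+1), the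
    diagonal of the combination is -(d+L+1), -(d+L+2) r, and neither entry vanishes. *)
Lemma shift_raise_lead_unit (R : realType) (n m i k : R) d :
  0 < i -> i < n -> 0 <= m -> 0 <= k ->
  (shift_poly n m i k)`_2 *+ d + (raise_poly n m i k)`_1 \is a GRing.unit.
Proof.
move=> i0 ni m0 k0; have ik : i + k != 0 by rewrite gt_eqF //; lra.
have ik1' : i + k + 1 != 0 by rewrite gt_eqF //; lra.
have nu0 : n - i != 0 by rewrite subr_eq0 gt_eqF.
have q0 := lt0r_neq0 (fam_q_gt0 m0 ni).
have d0 : 0 <= d%:R :> R by exact: ler0n.
rewrite !coef_qpoly /= -scaler_nat -(rmorph_nat (real_complex R)) -rmxZ -rmxD.
apply: rmx_unit; rewrite mx2Z mx2D; apply: mx2_unit.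
have -> : d%:R * (-1 + fam_nu n i / (fam_q n m i * (i + k + 1)) * fam_g1 n m i)
    = - d%:R * ((i + k) / (i + k + 1)).
  by rewrite /fam_g1 /fam_q /fam_nu; field; rewrite ?nu0 ?q0 ?ik1'.
rewrite mulr0 add0r mul0r subr0.
have -> : (d%:R * -1 + (- (m + n + 2 * k + 1) - 1)) *
  (- d%:R * ((i + k) / (i + k + 1)) +
   - ((i + k) / (i + k + 1)) * (m + n + 2 * k + 1 + 2))
  = (d%:R + m + n + 2 * k + 2) * (d%:R + m + n + 2 * k + 3) * ((i + k) / (i + k + 1)).
  by field; rewrite ?ik1'.
by rewrite !mulf_neq0 ?invr_neq0 // gt_eqF //; lra.
Qed.

End FamilyIdentities.

(** * Total mass, differential operator and positivity of the weight *)

Section FamilyWeight.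

Local Open Scope complex_scope.
Local Open Scope sesquilinear_scope.

(** The recursion of the beta moments, obtained by integrating [delta] of 1 and of ['X]. *)
Lemma wint_recursion (R : realType) (a b : R) : 0 <= a -> 0 <= b ->
  (a + b + 2) * wint a b 'X = (a + 1) * wint a b 1 /\
  (a + b + 3) * wint a b 'X^2 = (a + 2) * wint a b 'X.
Proof.
move=> a0 b0; have h p q c d : delta (a + 1) (b + 1) p = c *: q - d *: ('X * q) ->
    d * wint a b ('X * q) = c * wint a b q.
  move=> e; have := wint_delta p a0 b0; rewrite e -scaleNr wintD // !wintZ //.
  by move/eqP; rewrite mulNr subr_eq0 => /eqP.
split.
  have := h 1 1 (a + 1) (a + b + 2); rewrite mulr1; apply.
  by rewrite /delta derivC mulr0 add0r !mulr1 -!mul_polyC !(polyCD, polyC1, polyC_natr); ring.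
have := h 'X 'X (a + 2) (a + b + 3); rewrite -expr2; apply.
by rewrite /delta derivX -!mul_polyC !(polyCD, polyC1, polyC_natr); ring.
Qed.

Lemma mom_qpoly (R : realType) (a b : R) (A0 A1 A2 : 'M[R]_2) :
  mom a b (qpoly A0 A1 A2)
  = rmx (wint a b 1 *: A0 + wint a b 'X *: A1 + wint a b 'X^2 *: A2).
Proof.
rewrite (@mom_wide _ _ 3) ?size_qpoly // !big_ord_recl big_ord0 /= !coef_qpoly /=.
by rewrite addr0 addrA !rmxD !rmxZ expr0 expr1.
Qed.

(* Up to the positive factor [wint a b 1 ^+ 2], the determinant is
   [e1 t E((1 - g)^2) + t^2 Var g], where E is the expectation for the beta
   distribution and [e1] its mean. *)
Lemma mom_weight_poly_unit (R : realType) (n m i k : R) :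
  0 < i -> i + 1 <= n -> 0 <= m -> 0 <= k ->
  mom (m + k) (n - 1 + k) (weight_poly n m i k) \is a GRing.unit.
Proof.
move=> i0 ni m0 k0; rewrite mom_qpoly; apply: rmx_unit.
set a := m + k; set b := n - 1 + k.
have a0 : 0 <= a by rewrite /a; lra.
have b0 : 0 <= b by rewrite /b; lra.
have [h1 h2] := wint_recursion a0 b0; have w0 := wint_gt0 a0 b0.
move: h1 h2 w0; move: (wint a b 1) (wint a b 'X) (wint a b 'X^2) => w0 w1 w2 h1 h2 hw.
have S0 : a + b + 2 != 0 by rewrite gt_eqF //; lra.
have S1 : a + b + 3 != 0 by rewrite gt_eqF //; lra.
have e1 : w1 = (a + 1) / (a + b + 2) * w0.
  by apply: (mulfI S0); rewrite h1; field.
have e2 : w2 = (a + 2) / (a + b + 3) * w1.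
  by apply: (mulfI S1); rewrite h2; field.
rewrite !(mx2Z, mx2D); apply: mx2_unit; rewrite !mulr0 !addr0 !mulr1.
have t0 : 0 < fam_t n i k by rewrite /fam_t divr_gt0 // /fam_nu; lra.
have g10 : fam_g1 n m i != 0.
  by rewrite /fam_g1 /fam_q mulf_neq0 ?invr_neq0 // /fam_nu gt_eqF //; lra.
move: (fam_t n i k) (fam_g0 n m i) (fam_g1 n m i) t0 g10 => t g0 g1 t0 g10.
(* Mean and variance of the beta distribution with parameters a+1, b+1. The second moment of 1 - g
   is split into squared mean plus variance. *)
pose m1 := (a + 1) / (a + b + 2).
pose v := (a + 1) * (b + 1) / ((a + b + 2) ^+ 2 * (a + b + 3)).
have m10 : 0 < m1 by rewrite divr_gt0 //; lra.
have v0 : 0 < v by rewrite divr_gt0 ?mulr_gt0 ?exprn_gt0 //; lra.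
rewrite (_ : _ - _ = w0 ^+ 2 * (m1 * t * ((1 - g0 - g1 * m1) ^+ 2 + g1 ^+ 2 * v)
   + t ^+ 2 * g1 ^+ 2 * v)); last first.
  by rewrite e2 e1 /m1 /v; field; rewrite S0 S1.
have g1p : 0 < g1 ^+ 2 by rewrite exprn_even_gt0.
move: m1 v (g1 ^+ 2) m10 v0 g1p => m1 v g m10 v0 gp; rewrite gt_eqF //.
apply: mulr_gt0; first exact: exprn_gt0.
apply: addr_gt0; apply: mulr_gt0 => //; first exact: mulr_gt0.
  by apply: ltr_wpDl; [exact: sqr_ge0|exact: mulr_gt0].
by apply: mulr_gt0 => //; exact: exprn_gt0.
Qed.

Definition fam_F1 (R : realType) (n m i k : R) : {poly 'M[R[i]]_2} :=
  let q := n + m + 1 - i in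
  qpoly (mx2 ((m + 1) * (m + n + 2 - i) / q + k) ((n - i) / q) ((m + 1) / q)
      ((m ^+ 2 - 2 * i + 2 * n - m * i + 2 * m + m * n + 1) / q + k))
    (mx2 (- (n + m + 2 + 2 * k)) 0 1 (- (n + m + 3 + 2 * k))) 0.

Definition fam_F0 (R : realType) (n m i k : R) : {poly 'M[R[i]]_2} :=
  qpoly (mx2 (- (k * (n + m + 2) + k * (k - 1))) 0 k
      (- (n + m + 1 - i + k * (n + m + 3) + k * (k - 1)))) 0 0.

Lemma DopE (R : realType) (n m i : nat) (k : R) :
  Dop n m i k = DiffOp ('X * (1 - 'X)) (fam_F1 n%:R m%:R i%:R k) (fam_F0 n%:R m%:R i%:R k).
Proof.
rewrite /Dop; congr DiffOp; apply: mpeval_inj => y.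
- rewrite mpevalD mpevalN mpevalM mpevalX !mpevalC mpeval_qpoly.
  rewrite -mulmxE mul_scalar_mx /Cmx /Umx !mx2_scalar /rmx !scaler0 !addr0.
  rewrite !(mx2Z, mx2D, mx2N) map_mx2 /=.
  by congr mx2; 
    rewrite ?(rmorphD, rmorphN, rmorphB, rmorphM, fmorphV, rmorphXn, rmorph_nat,
              rmorph1, rmorph0) /=; ring.
- rewrite mpevalN !mpevalC mpeval_qpoly.
  rewrite /Vmx /Umx !mx2_scalar /rmx !scaler0 !addr0.
  rewrite !(mx2Z, mx2D, mx2N) map_mx2 /=.
  by congr mx2; 
    rewrite ?(rmorphD, rmorphN, rmorphB, rmorphM, fmorphV, rmorphXn, rmorph_nat,
              rmorph1, rmorph0) /=; ring.
Qed.

(** The first-order equation of [diffop_symmetric]; its constant antisymmetric matrix is the one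
    that also solves the zeroth-order equation in [fam_F0_weight]. *)
Lemma fam_F1_weight (R : realType) (n m i k : R) : 0 < i -> i < n -> 0 <= m -> 0 <= k ->
  fam_F1 n m i k * weight_poly n m i k = 'X * (1 - 'X) * (weight_poly n m i k)^`()
    + jacobi_s 1 (m + k + 1) (n + k) * weight_poly n m i k
    + 'X * (1 - 'X) * (rmx (fam_q n m i / (i + k) *: mx2 0 (-1) 1 0))%:P.
Proof.
move=> i0 ni m0 k0; have ik : i + k != 0 by rewrite gt_eqF //; lra.
have nu0 : n - i != 0 by rewrite subr_eq0 gt_eqF.
have q0 : n + m + 1 - i != 0 by rewrite gt_eqF //; lra.
apply: mpeval_inj => y; rewrite deriv_qpoly 2!mpevalD !(mpevalM ('X * (1 - 'X))).
rewrite mpeval_X1X !mpevalM mpeval_jacobi_s mpevalC !mpeval_qpoly -!rmxM -!rmxD; congr rmx.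
rewrite !mx2_scalar !scaler0 !addr0 !(mx2Z, mx2D, mx2M) /fam_t /fam_g0 /fam_g1 /fam_q /fam_nu.
by congr mx2; field; rewrite ?nu0 ?q0 ?ik.
Qed.

Lemma fam_F0_weight (R : realType) (n m i k : R) : 0 < i -> i < n -> 0 <= m -> 0 <= k ->
  fam_F0 n m i k * weight_poly n m i k - weight_poly n m i k * adjp (fam_F0 n m i k)
  = jacobi_s 1 (m + k + 1) (n + k) * (rmx (fam_q n m i / (i + k) *: mx2 0 (-1) 1 0))%:P.
Proof.
move=> i0 ni m0 k0; have ik : i + k != 0 by rewrite gt_eqF //; lra.
have nu0 : n - i != 0 by rewrite subr_eq0 gt_eqF.
apply: mpeval_inj => y; rewrite adjp_qpoly mpevalD mpevalN !mpevalM.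
rewrite mpeval_jacobi_s mpevalC !mpeval_qpoly.
rewrite -!rmxM -rmxN -!rmxD; congr rmx.
rewrite !trmx0 !mx2_scalar !scaler0 !addr0 mx2T !(mx2Z, mx2D, mx2M, mx2N).
rewrite /fam_t /fam_g0 /fam_g1 /fam_q /fam_nu.
by congr mx2; field; rewrite ?nu0 ?q0 ?ik.
Qed.

Lemma Wmx_wgt (R : realType) (n m i : nat) (k y : R) : (i < n)%N -> 0 < y < 1 ->
  Wmx n m i k y = (wgt (m%:R + k) (n%:R - 1 + k) y)%:C
                    *: mpeval (weight_poly n%:R m%:R i%:R k) y.
Proof.
move=> ni /andP[y0 y1].
have nu0 : n%:R - i%:R != 0 :> R by rewrite subr_eq0 eqr_nat gtn_eqF.
have nu0' : i%:R - n%:R != 0 :> R by rewrite subr_eq0 eqr_nat ltn_eqF.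
rewrite /Wmx /Psi0 /Tmx -/(rmx _) -/(rmx _) adj_rmx !mulmxE -!rmxM -!rmxZ mpeval_qpoly -rmxZ.
congr rmx; set h := (_ - _) / _.
(* The half powers of y occur only in pairs, so the quotient of the weight by [wgt] is
   polynomial. *)
have hy : y `^ 2^-1 * y `^ 2^-1 = y.
  rewrite -powRD ?(gt_eqF y0) ?implybT // (_ : 2^-1 + 2^-1 = 1) ?powRr1 1?ltW //.
  by field.
have hm : y `^ (m%:R / 2) * y `^ (m%:R / 2) = y `^ m%:R.
  by rewrite -powRD ?(gt_eqF y0) ?implybT //; congr (_ `^ _); field.
have hh : h = fam_g0 n%:R m%:R i%:R + fam_g1 n%:R m%:R i%:R * y.
  by rewrite /h /fam_g0 /fam_g1 /fam_q /fam_nu; field; rewrite nu0 nu0'.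
rewrite /wgt (@powRD _ y m%:R k) ?(gt_eqF y0) ?implybT // -hm !mx2Z mx2T !mx2M !(mx2Z, mx2D) hh.
rewrite -/(fam_nu n%:R i%:R) -/(fam_t n%:R i%:R k).
move: (y `^ (m%:R / 2)) (y `^ k) ((1 - y) `^ _) (y `^ 2^-1) hy => u v w s <-.
by congr mx2; ring.
Qed.

(** At v = (x,z) the form is c (y |x+z|^2 + t |x+gz|^2). Both squares vanish only at v = 0 because g
    - 1 = q(y-1)/nu is nonzero for y < 1. *)
Lemma posdef_weight_poly (R : realType) (n m i k c y : R) :
  0 < i -> i < n -> 0 <= m -> 0 <= k ->
  0 < c -> 0 < y < 1 -> posdefmx (c%:C *: mpeval (weight_poly n m i k) y).
Proof.
move=> i0 ni m0 k0 c0 /andP[y0 y1].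
pose g := fam_g0 n m i + fam_g1 n m i * y.
have t0 : 0 < fam_t n i k by rewrite /fam_t divr_gt0 // /fam_nu; lra.
have g1 : g != 1.
  have nu0 : n - i != 0 by rewrite subr_eq0 gt_eqF.
  rewrite -subr_eq0 (_ : g - 1 = (m + 1 + (n - i)) * (y - 1) / (n - i)).
    rewrite !mulf_neq0 ?invr_neq0 // ?subr_eq0 ?(lt_eqF y1) //.
    by rewrite gt_eqF // fam_q_gt0.
  by rewrite /g /fam_g0 /fam_g1 /fam_q /fam_nu; field.
have E : c%:C *: mpeval (weight_poly n m i k) y
   = rmx (c *: mx2 (y + fam_t n i k) (y + fam_t n i k * g) (y + fam_t n i k * g)
                   (y + fam_t n i k * g ^+ 2)).
  rewrite mpeval_qpoly -rmxZ; congr rmx; congr (_ *: _); rewrite !(mx2Z, mx2D) /g.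
  by congr mx2; ring.
rewrite E; split; first by rewrite adj_rmx linearZ /= mx2T.
move=> v v0; set x := v 0 0; set z := v 0 1.
have cr (r : R) : Num.conj r%:C = r%:C by exact: conjc_real.
have -> : (v *m rmx (c *: mx2 (y + fam_t n i k) (y + fam_t n i k * g) (y + fam_t n i k * g)
                   (y + fam_t n i k * g ^+ 2)) *m v^t*) 0 0
  = c%:C * (y%:C * ((x + z) * Num.conj (x + z))
        + (fam_t n i k)%:C * ((x + g%:C * z) * Num.conj (x + g%:C * z))).
  rewrite !mxE !big_ord_recl !big_ord0 /= !mxE !big_ord_recl !big_ord0 /= !mxE /=.
  rewrite (_ : lift ord0 ord0 = 1); last by apply/val_inj.
  rewrite -/x -/z !(rmorphD, rmorphM, rmorphXn) /= !cr.
  ring.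
have p1 := mul_conjC_ge0 (x + z).
have p2 := mul_conjC_ge0 (x + g%:C * z).
have yc : 0 < y%:C by rewrite ltcR.
have tc : 0 < (fam_t n i k)%:C by rewrite ltcR.
have q1 := mulr_ge0 (ltW yc) p1; have q2 := mulr_ge0 (ltW tc) p2.
rewrite pmulr_rgt0 ?ltcR // lt0r (addr_ge0 q1 q2) andbT paddr_eq0 //.
rewrite !mulf_eq0 (gt_eqF yc) (gt_eqF tc) !conjC_eq0 /= !orbb.
apply: contra v0 => /andP[/eqP h1 /eqP h2].
have z0 : z = 0.
  have /eqP : (g%:C - 1) * z = 0 by rewrite mulrBl mul1r -[RHS](subrr 0) -{1}h2 -h1; ring.
  rewrite mulf_eq0 subr_eq0 => /orP[/eqP h|/eqP //].
  by move: g1; rewrite -(inj_eq (@complexI R)) h eqxx.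
have x0 : x = 0 by rewrite -h1 z0 addr0.
by apply/eqP/matrixP => p q; rewrite mxE ord1; case: q => [[|[|//]] hq];
  [rewrite -[RHS]x0 /x | rewrite -[RHS]z0 /z]; congr (v _ _); apply/val_inj.
Qed.

End FamilyWeight.

(** * Specialisation of the abstract theory to the family *)

Lemma posdef_unit (R : realType) N (A : 'M[R[i]]_N) : posdefmx A -> A \in unitmx.
Proof.
case=> _ pA; rewrite -row_free_unit -kermx_eq0; apply: contraT => /rowV0Pn[v vA v0].
have := pA v v0; rewrite (sub_kermxP vA) mul0mx mxE ltxx //.
Qed.

Lemma size_X1X (R : realType) N :
  (size ('X * (1 - 'X) : {poly 'M[R[i]]_N.+1})%R <= 3)%N.
Proof.
apply/leq_sizeP => k hk; rewrite coefXM coefB coef1 coefX.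
by case: k hk => [|[|[|k]]] //= _; rewrite subrr.
Qed.

Section Main.

Local Open Scope complex_scope.

Variables (R : realType) (n m i : nat) (kappa : R).
Hypothesis i_gt0 : (0 < i)%N.
Hypothesis i_lt : (i < n)%N.
Hypothesis kappa_ge0 : 0 <= kappa.

Let a : R := m%:R + kappa.
Let b : R := n%:R - 1 + kappa.
Let M j := weight_poly n%:R m%:R i%:R (kappa + j%:R).
Let Phi j := shift_poly n%:R m%:R i%:R (kappa + j%:R).
Let A j := raise_poly n%:R m%:R i%:R (kappa + j%:R).

Let i0 : 0 < i%:R :> R. Proof. by rewrite ltr0n. Qed.
Let ni : i%:R < n%:R :> R. Proof. by rewrite ltr_nat. Qed.
Let m0 : 0 <= m%:R :> R. Proof. exact: ler0n. Qed.
Let k0 j : 0 <= kappa + j%:R. Proof. by rewrite addr_ge0. Qed.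
Let a0 : 0 <= a. Proof. by rewrite addr_ge0. Qed.
Let b0 : 0 <= b.
Proof. by rewrite addr_ge0 // subr_ge0 ler1n (leq_trans _ i_lt). Qed.
Let aj j : a + j%:R = m%:R + (kappa + j%:R). Proof. by rewrite addrA. Qed.
Let bj j : b + j%:R = n%:R - 1 + (kappa + j%:R). Proof. by rewrite addrA. Qed.
Let adjM j : adjp (M j) = M j. Proof. exact: adjp_weight_poly. Qed.
Let PhiM j : 'X * (1 - 'X) * M j.+1 = Phi j * M j.
Proof. by rewrite /M -natr1 addrA X1X_weight_poly. Qed.
Let AM j : mdelta (a + j.+1%:R) (b + j.+1%:R) (M j.+1) = A j * M j.
Proof.
have -> : a + j.+1%:R = m%:R + (kappa + j%:R) + 1 by rewrite /a -natr1; ring.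
have -> : b + j.+1%:R = n%:R + (kappa + j%:R) by rewrite /b -natr1; ring.
by rewrite /M -natr1 (addrA kappa) mdelta_weight_poly.
Qed.
Let size_Phi j : (size (Phi j) <= 3)%N. Proof. exact: size_qpoly. Qed.
Let size_A j : (size (A j) <= 2)%N. Proof. exact: size_qpoly2. Qed.
Let lead_unit j d : (Phi j)`_2 *+ d + (A j)`_1 \is a GRing.unit.
Proof. exact: shift_raise_lead_unit. Qed.
Let mom_unit j : mom (a + j%:R) (b + j%:R) (M j) \is a GRing.unit.
Proof. by rewrite aj bj mom_weight_poly_unit // natr1 ler_nat. Qed.

Lemma inner_Wmx j P Q :
  inner (Wmx n m i (kappa + j%:R)) P Q = ip a b M j P Q.
Proof.
rewrite /ip aj bj; apply: inner_wgt => [||y hy]; first by rewrite addr_ge0.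
  by rewrite -bj addr_ge0.
exact: Wmx_wgt.
Qed.

(** This equivalence contains both existence and uniqueness, and reduces every claim on monic
    orthogonal polynomials to one on [mop]. *)
Lemma monic_orthogonal_mop j (Q : nat -> {poly 'M[R[i]]_2}) :
  monic_orthogonal (Wmx n m i (kappa + j%:R)) Q <-> Q = mop Phi A j.
Proof.
split=> [[hQ ho]|->].
  apply/funext => d.
  apply: (orthogonal_mop a0 b0 adjM PhiM AM size_Phi size_A lead_unit mom_unit) => //.
  by move=> k l kl; rewrite -inner_Wmx ho.
split=> [d|k l kl].
  by split; [apply: mop_monic|apply: size_mop].
by rewrite inner_Wmx; apply: mop_orthogonal.
Qed.

Lemma monic_orthogonal_deriv (Q Q1 : nat -> {poly 'M[R[i]]_2}) d :
  monic_orthogonal (Wmx n m i kappa) Q ->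
  monic_orthogonal (Wmx n m i (kappa + 1)) Q1 ->
  (Q d)^`() = Q1 d.-1 *+ d.
Proof.
(* The parameters kappa and kappa + 1 are the indices 0 and 1 of the same abstract sequence. *)
rewrite -{1}[kappa]addr0 -[1]/(1%:R).
move=> /(monic_orthogonal_mop 0) -> /(monic_orthogonal_mop 1) ->.
exact: (mop_deriv a0 b0 adjM PhiM AM).
Qed.

Lemma mop_rodrigues d (y : R) : 0 < y < 1 ->
  mpeval (mop Phi A 0 d) y = ((rod Phi A 0 d)`_d)^-1
    *m mxderiven d (Wmx n m i (kappa + d%:R)) y *m invmx (Wmx n m i kappa y).
Proof.
move=> hy; have W0 := Wmx_wgt m kappa i_lt hy.
have uW : Wmx n m i kappa y \in unitmx.
  by rewrite W0; apply/posdef_unit/posdef_weight_poly => //; exact: wgt_gt0.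
rewrite (@mxderiven_wgt _ _ d _ _ _ _ (fun y => Wmx_wgt m (kappa + d%:R) i_lt)) //.
have := rod_weight PhiM AM 0 d; rewrite !add0n aj bj => ->.
(* The [d] derivatives bring the exponents of the weight at kappa + d back to those at kappa. *)
rewrite -aj -bj !addrK mpevalM /M addr0 /a /b.
rewrite -mulmxE scalemxAr -W0 mulmxA mulmxK // /mop mpevalM mpevalC mulmxE //.
Qed.

Lemma classical_pair_Wmx : classical_pair (Wmx n m i kappa) (Dop n m i kappa).
Proof.
have WE y := @Wmx_wgt R n m i kappa y i_lt; split.
- split.
  + exact: mxsmooth_wgt WE.
  + move=> y; rewrite in_itv /= => hy; rewrite WE //.
    by apply: posdef_weight_poly => //; exact: wgt_gt0.
  + move=> k.
    (* A power of y is absorbed into the matrix polynomial, so the scalar weight stays the same. *)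
    apply: (@mxintegrable_wgt _ _ a b _ ('X^k * weight_poly n%:R m%:R i%:R kappa)) => // y hy.
    rewrite WE // scalerA mulrC -scalerA mpevalM; congr (_ *: _).
    rewrite /mpeval hornerXn -rmorphXn /= -rmorphXn /=.
    by rewrite -mulmxE mul_scalar_mx.
- rewrite DopE; split; [exact: size_X1X|exact: size_qpoly2|].
  apply/leq_sizeP => -[|k] // _; rewrite coef_qpoly.
  by case: k => [|[|k]]; rewrite /= ?nth_nil /rmx map_mx0.
- move=> P Q; rewrite !(inner_wgt _ _ a0 b0 WE) DopE.
  pose Z := fam_q n%:R m%:R i%:R / (i%:R + kappa) *: mx2 0 (-1) 1 0.
  apply: (diffop_symmetric (Z := rmx Z)) => //; rewrite /Z.
  + exact: adjp_weight_poly.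
  + rewrite adj_rmx linearZ /= mx2T -rmxN -scalerN mx2N opprK oppr0 //.
  + rewrite (_ : b + 1 = n%:R + kappa); last by rewrite /b; ring.
    exact: fam_F1_weight.
  + rewrite (_ : b + 1 = n%:R + kappa); last by rewrite /b; ring.
    exact: fam_F0_weight.
Qed.

End Main.

Theorem mainTheorem5 (R : realType) (n m i : nat) (kappa : R)
    (hn : (2 <= n)%N) (hi1 : (1 <= i)%N) (hi2 : (i <= n - 1)%N)
    (hkappa : 0 <= kappa) :
  classical_pair (Wmx n m i kappa) (Dop n m i kappa)
  /\ (exists! Q : nat -> {poly 'M[R[i]]_2},
        monic_orthogonal (Wmx n m i kappa) Q)
  /\ (forall Q Q1 : nat -> {poly 'M[R[i]]_2},
        monic_orthogonal (Wmx n m i kappa) Q ->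
        monic_orthogonal (Wmx n m i (kappa + 1)) Q1 ->
        forall d : nat, deriv (Q d) = Q1 d.-1 *+ d)
  /\ (forall Q : nat -> {poly 'M[R[i]]_2},
        monic_orthogonal (Wmx n m i kappa) Q ->
        forall d : nat, exists G : 'M[R[i]]_2, forall y : R, 0 < y < 1 ->
          mpeval (Q d) y =
            G *m mxderiven d (Wmx n m i (kappa + d%:R)) y
              *m invmx (Wmx n m i kappa y)).
Proof.
have i_lt : (i < n)%N by rewrite (leq_ltn_trans hi2) // subn1 prednK // (leq_trans _ hn).
have mo Q := monic_orthogonal_mop m hi1 i_lt hkappa 0 Q.
rewrite addr0 in mo.
split; first exact: classical_pair_Wmx.
split; first by eexists; split=> [|Q /mo ->]; first exact/mo.
split=> [Q Q1 hQ hQ1 d|Q /mo -> d]; first exact: monic_orthogonal_deriv hQ hQ1.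
by eexists => y hy; exact: mop_rodrigues.
Qed.
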